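(* Given a matrix $A\in\mathbb{R}^{n\times m}$, an integer $k\in\mathbb{N}$, an even integer $p\in\mathbb{N}$, and $0<\varepsilon<1$, there exists an algorithm that runs in time $n^{\mathcal{O}_p(\log^2(n)/\mathrm{poly}_p(\varepsilon))}$ and outputs vectors $\hat u\in\mathbb{R}^n$, $\hat v\in\mathbb{R}^m$ such that, with probability at least $0.99$, \[ \|A-\hat u\hat v^\top\|_p^p\le \mathrm{OPT}_{\mathrm{LRA}}+\varepsilon\cdot\|A\|_p^p . \]
   Context: For a matrix $M$, $\|M\|_p=\big(\sum_{i,j}|M_{ij}|^p\big)^{1/p}$ is the entrywise $\ell_p$ norm. The $\ell_p$ rank-one approximation optimum is $\mathrm{OPT}_{\mathrm{LRA}}=\min_{u\in\mathbb{R}^n,v\in\mathbb{R}^m}\|A-uv^\top\|_p^p$. The running time bound means: there is a constant $c_p$ depending only on $p$ such that the running time is at most $n^{c_p\log^2(n)\,\varepsilon^{-c_p}}$.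
   Formalization: The running time bound is multiplied by m/n when m exceeds n, and n = 1 is replaced by 2 in it, since writing the m coordinates of the second vector cannot be done in time independent of m and the bound equals 1 for n = 1; p, n and m are at least 1. *)

(* Defs.v *)
From HB Require Import structures.
From mathcomp Require Import all_boot all_order all_algebra.
From mathcomp Require Import all_classical all_reals all_analysis.

Set Implicit Arguments.
Unset Strict Implicit.
Unset Printing Implicit Defensive.

Import Order.TTheory GRing.Theory Num.Theory.

Local Open Scope classical_set_scope.
Local Open Scope ring_scope.

Section Approximation.
Variable R : realType.

Definition lpnorm (p n m : nat) (M : 'M[R]_(n, m)) : R :=
  (\sum_(i < n) \sum_(j < m) `|M i j| `^ p%:R) `^ (p%:R^-1).

(* The minimum is attained, because the matrices of rank at most one form a
   closed set, so that the infimum below is the minimum. *)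
Definition opt_lra (p n m : nat) (A : 'M[R]_(n, m)) : R :=
  inf [set lpnorm p (A - uv.1 *m uv.2^T) ^+ p | uv in [set: 'cV[R]_n * 'cV[R]_m]].

End Approximation.

(* Algorithms are programs of a randomized real RAM: exact field operations and
   comparisons on reals at unit cost, no rounding and no conversion from reals
   to integers; natural numbers (used for counting and indirect addressing) can
   only be added, subtracted (truncated) and compared. A program is a finite
   object in which no real constant occurs.

   The memory consists of arrays of naturals and arrays of reals. The name of an
   array is a literal of the program, the index is computed. The input is
   read-only. *)

Inductive nexpr : Type :=
| NConst of nat
| NRows | NCols | NRank | NPower
| NGet of nat & nexpr
| NAdd of nexpr & nexpr
| NSub of nexpr & nexpr.

Inductive rexpr : Type :=
| REps
| REntry of nexpr & nexpr
| ROfNat of nexpr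
| RGet of nat & nexpr
| RAdd of rexpr & rexpr
| RSub of rexpr & rexpr
| RMul of rexpr & rexpr
| RDiv of rexpr & rexpr.

Inductive bexpr : Type :=
| BNLe of nexpr & nexpr
| BRLe of rexpr & rexpr
| BNot of bexpr
| BAnd of bexpr & bexpr.

Inductive cmd : Type :=
| CSkip
| CNSet of nat & nexpr & nexpr
| CRSet of nat & nexpr & rexpr
| CFlip of nat & nexpr
| CSeq of cmd & cmd
| CIf of bexpr & cmd & cmd
| CWhile of bexpr & cmd.

(* The cost of an expression is its number of nodes, that is, of elementary
   operations. *)

Fixpoint ncost (e : nexpr) : nat :=
  match e with
  | NConst _ | NRows | NCols | NRank | NPower => 1
  | NGet _ i => (ncost i).+1
  | NAdd e1 e2 | NSub e1 e2 => (ncost e1 + ncost e2).+1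
  end.

Fixpoint rcost (e : rexpr) : nat :=
  match e with
  | REps => 1
  | REntry i j => (ncost i + ncost j).+1
  | ROfNat i | RGet _ i => (ncost i).+1
  | RAdd e1 e2 | RSub e1 e2 | RMul e1 e2 | RDiv e1 e2 =>
      (rcost e1 + rcost e2).+1
  end.

Fixpoint bcost (b : bexpr) : nat :=
  match b with
  | BNLe e1 e2 => (ncost e1 + ncost e2).+1
  | BRLe e1 e2 => (rcost e1 + rcost e2).+1
  | BNot b1 => (bcost b1).+1
  | BAnd b1 b2 => (bcost b1 + bcost b2).+1
  end.

Section Semantics.
Variable R : realType.

Record input : Type := Input {
  in_rows : nat;
  in_cols : nat;
  in_matrix : 'M[R]_(in_rows, in_cols);
  in_rank : nat;
  in_power : nat;
  in_eps : R }.

Record state : Type := State {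
  nmem : nat -> nat -> nat;
  rmem : nat -> nat -> R;
  coins : seq bool }.

Definition upd (T : Type) (mem : nat -> nat -> T) (a i : nat) (v : T) :
    nat -> nat -> T :=
  fun b j => if (b == a) && (j == i) then v else mem b j.

Definition nset (s : state) (a i v : nat) : state :=
  State (upd (nmem s) a i v) (rmem s) (coins s).

Definition rset (s : state) (a i : nat) (v : R) : state :=
  State (nmem s) (upd (rmem s) a i v) (coins s).

Definition entry (x : input) (i j : nat) : R :=
  match insub i, insub j with
  | Some i', Some j' => in_matrix x i' j'
  | _, _ => 0
  end.

Section WithInput.
Variable x : input.

Fixpoint neval (s : state) (e : nexpr) : nat :=
  match e with
  | NConst k => k
  | NRows => in_rows x
  | NCols => in_cols x
  | NRank => in_rank x
  | NPower => in_power x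
  | NGet a i => nmem s a (neval s i)
  | NAdd e1 e2 => (neval s e1 + neval s e2)%N
  | NSub e1 e2 => (neval s e1 - neval s e2)%N
  end.

(* Division by zero returns zero. *)
Fixpoint reval (s : state) (e : rexpr) : R :=
  match e with
  | REps => in_eps x
  | REntry i j => entry x (neval s i) (neval s j)
  | ROfNat i => (neval s i)%:R
  | RGet a i => rmem s a (neval s i)
  | RAdd e1 e2 => reval s e1 + reval s e2
  | RSub e1 e2 => reval s e1 - reval s e2
  | RMul e1 e2 => reval s e1 * reval s e2
  | RDiv e1 e2 => reval s e1 / reval s e2
  end.

Fixpoint beval (s : state) (b : bexpr) : bool :=
  match b with
  | BNLe e1 e2 => (neval s e1 <= neval s e2)%N
  | BRLe e1 e2 => reval s e1 <= reval s e2
  | BNot b1 => ~~ beval s b1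
  | BAnd b1 b2 => beval s b1 && beval s b2
  end.

(* exec c s t s': started in s, the command c halts in s' after t elementary
   steps. A coin flip consumes the head of coins and is stuck if there is
   none. *)
Inductive exec : cmd -> state -> nat -> state -> Prop :=
| exec_skip s :
    exec CSkip s 1 s
| exec_nset s a i e :
    exec (CNSet a i e) s (ncost i + ncost e).+1
      (nset s a (neval s i) (neval s e))
| exec_rset s a i e :
    exec (CRSet a i e) s (ncost i + rcost e).+1
      (rset s a (neval s i) (reval s e))
| exec_flip s a i b w :
    coins s = b :: w ->
    exec (CFlip a i) s (ncost i).+1
      (State (upd (nmem s) a (neval s i) (nat_of_bool b)) (rmem s) w)
| exec_seq c1 c2 s1 s2 s3 t1 t2 :
    exec c1 s1 t1 s2 -> exec c2 s2 t2 s3 ->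
    exec (CSeq c1 c2) s1 (t1 + t2)%N s3
| exec_if_true b c1 c2 s s' t :
    beval s b -> exec c1 s t s' ->
    exec (CIf b c1 c2) s (bcost b + t).+1 s'
| exec_if_false b c1 c2 s s' t :
    ~~ beval s b -> exec c2 s t s' ->
    exec (CIf b c1 c2) s (bcost b + t).+1 s'
| exec_while_false b c s :
    ~~ beval s b ->
    exec (CWhile b c) s (bcost b).+1 s
| exec_while_true b c s1 s2 s3 t1 t2 :
    beval s1 b -> exec c s1 t1 s2 -> exec (CWhile b c) s2 t2 s3 ->
    exec (CWhile b c) s1 (bcost b + t1 + t2).+1 s3.

Lemma exec_det c s t1 s1 t2 s2 :
  exec c s t1 s1 -> exec c s t2 s2 -> t1 = t2 /\ s1 = s2.
Proof.
move=> e1; elim: e1 t2 s2 => {c s t1 s1}.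
- by move=> s t2 s2 e2; inversion e2; subst.
- by move=> s a i e t2 s2 e2; inversion e2; subst.
- by move=> s a i e t2 s2 e2; inversion e2; subst.
- move=> s a i b w sw t2 s2 e2; inversion e2; subst.
  by match goal with H : coins s = _ |- _ => move: H end; rewrite sw => -[-> ->].
- move=> c1 c2 s1 s2 s3 t1 t2 _ IH1 _ IH2 t' s' e2; inversion e2; subst.
  match goal with H : exec c1 _ _ _ |- _ => case: (IH1 _ _ H) => ? ? end; subst.
  by match goal with H : exec c2 _ _ _ |- _ => case: (IH2 _ _ H) => ? ? end; subst.
- move=> b c1 c2 s s' t bT _ IH t' s'' e2; inversion e2; subst.
    by match goal with H : exec c1 _ _ _ |- _ => case: (IH _ _ H) => ? ? end; subst.
  by match goal with H : is_true (~~ _) |- _ => rewrite bT in H end.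
- move=> b c1 c2 s s' t bF _ IH t' s'' e2; inversion e2; subst.
    by match goal with H : is_true (beval _ _) |- _ => rewrite H in bF end.
  by match goal with H : exec c2 _ _ _ |- _ => case: (IH _ _ H) => ? ? end; subst.
- move=> b c s bF t' s'' e2; inversion e2; subst => //.
  by match goal with H : is_true (beval _ _) |- _ => rewrite H in bF end.
- move=> b c s1 s2 s3 t1 t2 bT _ IH1 _ IH2 t' s'' e2; inversion e2; subst.
    by match goal with H : is_true (~~ _) |- _ => rewrite bT in H end.
  match goal with H : exec c _ _ _ |- _ => case: (IH1 _ _ H) => ? ? end; subst.
  by match goal with H : exec (CWhile _ _) _ _ _ |- _ => case: (IH2 _ _ H) => ? ? end; subst.
Qed.

End WithInput.

Definition init (w : seq bool) : state :=
  State (fun _ _ => 0%N) (fun _ _ => 0) w.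

(* The output vectors are the initial segments of the real arrays 0 and 1. *)
Definition outu (n : nat) (s : state) : 'cV[R]_n := \col_(i < n) rmem s 0 i.
Definition outv (m : nat) (s : state) : 'cV[R]_m := \col_(j < m) rmem s 1 j.

(* Every coin flip costs at least one step, so that T coins are enough for a run
   of at most T steps. *)
Definition runs_in (c : cmd) (x : input) (T : nat) : Prop :=
  forall w : T.-tuple bool,
    exists (t : nat) (s : state), (t <= T)%N /\ exec x c (init w) t s.

(* Probability, over T independent fair coins, that c halts on x in a state
   satisfying Q. *)
Definition prob_output (c : cmd) (x : input) (T : nat) (Q : state -> Prop) : R :=
  #|[set w : T.-tuple bool |
      `[< exists (t : nat) (s : state), exec x c (init w) t s /\ Q s >]]%SET|%:R
  / 2%:R ^+ T.

(* For 2 <= n and m <= n this is n `^ (c * (ln n) ^ 2 * eps `^ (- c)). Writing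
   the m coordinates of the second output vector takes m steps, so that a bound
   that does not depend on m is impossible for large m: the factor m / n accounts
   for m > n. For n = 1 the power of n is 1 for every c; n is replaced by 2. *)
Definition time_bound (c : R) (n m : nat) (eps : R) : R :=
  let N := maxn n 2 in
  (maxn N m)%:R / N%:R * N%:R `^ (c * ln N%:R ^+ 2 * eps `^ (- c)).

End Semantics.

(* Main.v *)
Require Import Defs.
From HB Require Import structures.
From mathcomp Require Import all_boot all_order all_algebra.
From mathcomp Require Import all_classical all_reals all_analysis.
From mathcomp Require Import ring lra zify.

Set Implicit Arguments.
Unset Strict Implicit.
Unset Printing Implicit Defensive.

Import Order.TTheory GRing.Theory Num.Theory.

Local Open Scope ring_scope.

(** The algorithm uses no coins. Fix a rank-one matrix [u v^T] with [u] of
    [l_p] norm at most one. Given [u], the best [v j] minimises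
    [sum_i (A i j - u i t)^p] over [t]. Entries with [|A i j|] much larger than
    [|u i|] times the norm of the [j]-th column contribute almost a constant to
    this function of [t]; the other ones contribute
    [sum_i u_i^p (A i j / u i - t)^p], the mean of a bounded variable over a row
    chosen with probability proportional to [u_i^p]. Hence a number of sampled
    rows polynomial in [1 / eps], together with the values of [u] there,
    determines a nearly optimal [v]. After rounding [u] to a grid of size
    polynomial in [n] and [1 / eps], the rows and the values of [u] there can be
    guessed exhaustively. Each guess yields a [v], then [v] yields the best [u]
    on the grid, and the cheapest of all these pairs is returned. *)

(** * Approximation by guessing *)

(** One sample of rows has to serve all [m] columns, yet its size must not depend on [m]. So no
    column is controlled individually: only the sum, over all columns and all grid values of [t], of
    the squared sampling errors is kept small, each weighted by the inverse [p]-th power of the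
    scale of its column; AM-GM then turns it into a total error proportional to $\|A\|_p^p$. Since
    all guesses are tried, one good sample is enough, and a greedy choice shows that it exists. A
    single integer [W], the least with [1024 ^+ p <= W * eps], governs all parameters, and every
    loss is $O_p(1/W)\,\|A\|_p^p$. The grid for [v] has relative step $W^{-(p+1)}$ because absorbing
    the rounding errors costs a factor $(1+W)^p$; the grid for [u] is finer by a factor [n] because
    its errors add up over the rows. The sample size $W^{3p+3}$ pays for $O(W^{p+1})$ grid values,
    squared bounds of relative size $O_p(W^{2p})$, and two factors [W] from AM-GM and the target
    accuracy. The machine has no roots, so column norms are known only up to a factor of two. *)

Section Argmin.
Variable R : realType.

(** Ties go to the smaller index; the value at [G = 0] is a dummy. The minimisation loop of the
    program follows the same recursion. *)
Fixpoint amin (F : nat -> R) (G : nat) : nat :=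
  if G is g.+1 then (if F (amin F g) <= F g then amin F g else g) else 0%N.

Lemma amin_le F G i : (i < G)%N -> F (amin F G) <= F i.
Proof.
elim: G => // G IH; rewrite ltnS leq_eqVlt => /orP[/eqP ->|iG] /=.
  by case: ifP.
by case: ifPn => [_|]; [exact: IH|rewrite -ltNge => /ltW h; exact: le_trans h (IH iG)].
Qed.

Lemma amin_lt F G : (0 < G)%N -> (amin F G < G)%N.
Proof.
case: G => // G _; elim: G => [|G IH] /=; first by case: ifP.
by rewrite [X in (X < _)%N](_ : _ = if F (amin F G.+1) <= F G.+1 then amin F G.+1 else G.+1) //; case: ifP => // _; exact: leqW.
Qed.

End Argmin.

(** * Perturbation of even powers, and rounding *)

Section Powers.
Variable R : realType.
Implicit Types (x y d t : R) (p : nat).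

Lemma even_expr_norm p x : ~~ odd p -> `|x| ^+ p = x ^+ p.
Proof. by move=> po; rewrite -normrX ger0_norm // exprn_even_ge0. Qed.

(** The right side is the chord over [0, 1] of a convex function; induction on [p] replaces
    convexity. *)
Lemma expr1D_le p t : 0 <= t <= 1 -> (1 + t) ^+ p <= 1 + (2 ^+ p - 1) * t.
Proof.
move=> /andP[t0 t1]; elim: p => [|p IH]; first by rewrite !expr0 subrr mul0r addr0.
rewrite exprS (le_trans (ler_wpM2l _ IH)) ?addr_ge0 //.
have h : 1 <= 2 ^+ p :> R by apply: exprn_ege1; lra.
rewrite exprS; move: h; set X := 2 ^+ p => h.
have : 0 <= (X - 1) * (t * (1 - t)) by rewrite !mulr_ge0 ?subr_ge0.
by lra.
Qed.

Lemma expr1B_ge p t : 0 <= t <= 1 -> 1 - (2 ^+ p - 1) * t <= (1 - t) ^+ p.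
Proof.
move=> /andP[t0 t1]; elim: p => [|p IH]; first by rewrite !expr0 subrr mul0r subr0.
have t1' : 0 <= 1 - t by rewrite subr_ge0.
rewrite [leRHS]exprS; apply: le_trans (ler_wpM2l t1' IH).
have h : 1 <= 2 ^+ p :> R by apply: exprn_ege1; lra.
rewrite exprS; move: h; set X := 2 ^+ p => h.
have : 0 <= (X - 1) * (t * (1 + t)) by rewrite !mulr_ge0 ?subr_ge0 ?addr_ge0.
by lra.
Qed.

(** The error is a fraction of [x ^+ p] itself, so that summed over the large entries of a column it
    stays a small fraction of the column sum. *)
Lemma expr_relative_perturb p x d t : ~~ odd p -> 0 <= t <= 1 -> `|d| <= t * `|x| ->
  `|(x - d) ^+ p - x ^+ p| <= 2 ^+ p * t * x ^+ p.
Proof.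
move=> po t01 dx; have /andP[t0 t1] := t01.
have xp0 : 0 <= x ^+ p by rewrite exprn_even_ge0.
rewrite -(even_expr_norm (x - d) po).
have up : `|x - d| ^+ p <= (1 + t) ^+ p * x ^+ p.
  rewrite -(even_expr_norm x po) -exprMn lerXn2r ?nnegrE ?mulr_ge0 ?addr_ge0 //.
  by rewrite (le_trans (ler_normB _ _)) // mulrDl mul1r lerD2l.
have lo : (1 - t) ^+ p * x ^+ p <= `|x - d| ^+ p.
  rewrite -(even_expr_norm x po) -exprMn lerXn2r ?nnegrE ?mulr_ge0 ?subr_ge0 //.
  by have := lerB_dist x d; lra.
have u2 := ler_wpM2r xp0 (expr1D_le p t01).
have l2 := ler_wpM2r xp0 (expr1B_ge p t01).
have tx : 0 <= t * x ^+ p by rewrite mulr_ge0.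
by rewrite ler_norml; apply/andP; split; nra.
Qed.

(** If [|d| <= t * |x|] the first term alone suffices, otherwise the second one does. A small [t]
    keeps the coefficient of [x ^+ p] near one at the price of a large coefficient on the error. *)
Lemma expr_add_perturb p x d t : ~~ odd p -> 0 < t ->
  (x + d) ^+ p <= (1 + t) ^+ p * x ^+ p + (1 + t^-1) ^+ p * d ^+ p.
Proof.
move=> po t0; rewrite -(even_expr_norm (x + d) po) -(even_expr_norm x po) -(even_expr_norm d po).
have t0' := ltW t0; have t1 : 0 <= t^-1 by rewrite invr_ge0.
rewrite -!exprMn.
have [dx|xd] := lerP `|d| (t * `|x|).
  apply: (@le_trans _ _ (((1 + t) * `|x|) ^+ p)).
    rewrite lerXn2r ?nnegrE ?mulr_ge0 ?addr_ge0 //.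
    by rewrite (le_trans (ler_normD _ _)) // mulrDl mul1r lerD2l.
  by rewrite lerDl exprn_ge0 // mulr_ge0 ?addr_ge0.
apply: (@le_trans _ _ (((1 + t^-1) * `|d|) ^+ p)).
  rewrite lerXn2r ?nnegrE ?mulr_ge0 ?addr_ge0 //.
  rewrite ltW // (le_lt_trans (ler_normD _ _)) // mulrDl mul1r addrC ltrD2l.
  by rewrite mulrC ltr_pdivlMr // mulrC.
by rewrite lerDr exprn_ge0 // mulr_ge0 ?addr_ge0.
Qed.

Lemma exprD_le2 p x y : 0 <= x -> 0 <= y ->
  (x + y) ^+ p <= 2 ^+ p * (x ^+ p + y ^+ p).
Proof.
move=> x0 y0; wlog xy : x y x0 y0 / x <= y.
  by move=> h; have [/h->//|/ltW/h] := lerP x y; rewrite addrC [_ ^+ p + _]addrC; exact.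
apply: (@le_trans _ _ ((2 * y) ^+ p)).
  by rewrite lerXn2r ?nnegrE ?addr_ge0 ?mulr_ge0 //; lra.
by rewrite exprMn ler_wpM2l ?exprn_ge0 // lerDr exprn_ge0.
Qed.

(** Rounding goes towards zero rather than to the nearest integer, so that absolute values do not
    grow and a rounded [u] keeps norm at most one. The code [g] is shifted by [k] to be a natural
    number. *)
Lemma round_to_zero (k : nat) x : `|x| <= k%:R ->
  exists g : nat, [/\ (g < k + k + 1)%N, `|g%:R - k%:R| <= `|x| & `|g%:R - k%:R - x| <= 1].
Proof.
move=> xk; have n0 := normr_ge0 x.
have /andP[h1 h2] := truncn_itv n0.
set q := Num.truncn `|x| in h1 h2.
have qk : (q <= k)%N by rewrite -(@ler_nat R); exact: le_trans xk.
move: h2; rewrite -natr1 => h2.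
have [x0|x0] := lerP 0 x.
  exists (k + q)%N; rewrite natrD addrAC subrr add0r; split; first by lia.
    by rewrite ger0_norm.
  by move: h1 h2; rewrite ger0_norm // => h1 h2; rewrite ler_norml; apply/andP; split; lra.
exists (k - q)%N; rewrite natrB // addrAC subrr add0r; split; first by lia.
  by rewrite normrN ger0_norm.
by move: h1 h2; rewrite ltr0_norm // => h1 h2; rewrite ler_norml; apply/andP; split; lra.
Qed.

End Powers.

(** * Derandomised sampling by second moments *)

Section Sampling.
Variable R : realType.

(* Rows are picked one at a time. Averaged over the next row the cross terms
   vanish, so that some choice increases the weighted sum of squares by at most
   the weighted second moment. *)
Lemma greedy_sampling (C : finType) (n : nat) (w : C -> R) (q : 'I_n -> R)
    (phi : C -> nat -> R) (bd : C -> R) :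
  (forall c, 0 <= w c) -> (forall i, 0 <= q i) -> \sum_i q i = 1 ->
  (forall c (i : 'I_n), 0 <= phi c i <= bd c) ->
  let mu c := \sum_i q i * phi c i in
  forall r : nat, exists f : nat -> nat, (forall k, (f k < n)%N) /\
    \sum_c w c * (\sum_(k < r) phi c (f k) - r%:R * mu c) ^+ 2
      <= r%:R * \sum_c w c * bd c ^+ 2.
Proof.
move=> w0 q0 q1 phib mu.
have [i0 _] : exists i0 : 'I_n, True.
  case: n q q0 q1 {mu phib} => [q _|n q _ _]; last by exists ord0.
  by rewrite big_ord0 => /eqP; rewrite eq_sym oner_eq0.
set V := \sum_c w c * bd c ^+ 2.
elim=> [|r [f [fn IH]]].
  exists (fun=> val i0); split; first by move=> k; exact: ltn_ord.
  by rewrite big1 ?mul0r // => c _; rewrite big_ord0 mul0r subrr expr0n mulr0.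
set S := fun c => \sum_(k < r) phi c (f k) - r%:R * mu c in IH.
pose G (i : 'I_n) := \sum_c w c * (S c + (phi c i - mu c)) ^+ 2.
have avg : \sum_i q i * G i <= \sum_c w c * S c ^+ 2 + V.
  rewrite /G; under eq_bigr do rewrite mulr_sumr.
  rewrite exchange_big /= /V -big_split /=; apply: ler_sum => c _.
  rewrite (_ : \sum_i _ = w c * (S c ^+ 2 + \sum_i q i * (phi c i - mu c) ^+ 2)).
    rewrite -mulrDr ler_wpM2l // lerD2l.
    (* A variance is at most the second moment, hence at most [bd c ^+ 2]. *)
    have -> : \sum_i q i * (phi c i - mu c) ^+ 2 =
              \sum_i q i * phi c i ^+ 2 - mu c ^+ 2.
      transitivity (\sum_i (q i * phi c i ^+ 2 - (2 * mu c) * (q i * phi c i)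
                            + mu c ^+ 2 * q i)).
        by apply: eq_bigr => i _; ring.
      rewrite big_split /= sumrB -!mulr_sumr q1 -/(mu c); ring.
    rewrite (@le_trans _ _ (\sum_i q i * phi c i ^+ 2)) //; first by rewrite gerBl sqr_ge0.
    rewrite -[leRHS]mul1r -q1 mulr_suml; apply: ler_sum => i _.
    have /andP[p0 pb] := phib c i.
    by rewrite ler_wpM2l // lerXn2r ?nnegrE // (le_trans p0).
  transitivity (\sum_i (w c * S c ^+ 2 * q i + (2 * w c * S c) * (q i * phi c i)
       - (2 * w c * S c * mu c) * q i + w c * (q i * (phi c i - mu c) ^+ 2))).
    by apply: eq_bigr => i _; ring.
  rewrite big_split /= sumrB big_split /= -!mulr_sumr q1 -/(mu c); ring.
have [i Gi] : exists i, G i <= \sum_c w c * S c ^+ 2 + V.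
  apply: contrapT => /forallNP h.
  suff : \sum_c w c * S c ^+ 2 + V < \sum_i q i * G i by rewrite ltNge avg.
  set z := _ + V in h *.
  rewrite -[ltLHS]mul1r -q1 mulr_suml.
  (* Strictness of the averaged inequality needs one index of positive weight. *)
  have [i1 qi1] : exists i, 0 < q i.
    apply: contrapT => /forallNP hq; move/eqP: q1; rewrite big1 ?(eq_sym 0) ?oner_eq0 // => i _.
    by apply/eqP; rewrite eq_le q0 andbT leNgt; apply/negP/hq.
  rewrite (bigD1 i1) //= [ltRHS](bigD1 i1) //= ltr_leD //.
    by rewrite ltr_pM2l // ltNge; apply/negP/h.
  by apply: ler_sum => i _; rewrite ler_wpM2l // ltW // ltNge; apply/negP/h.
exists (fun k => if k == r then val i else f k); split.
  by move=> k; case: ifP => // _; exact: ltn_ord.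
rewrite -natr1 mulrDl mul1r.
apply: le_trans (_ : G i <= _); last by apply: le_trans Gi _; rewrite lerD2r.
rewrite le_eqVlt; apply/orP; left; apply/eqP/eq_bigr => c _; congr (_ * _ ^+ 2).
rewrite big_ord_recr /= eqxx mulrDl mul1r /S.
under eq_bigr => k _ do rewrite (ltn_eqF (ltn_ord k)).
by ring.
Qed.

End Sampling.

(** * Grids, guesses, and the existence of a good guess *)

Section Algorithm.
Variables (R : realType) (n m p : nat) (a : nat -> nat -> R) (W : nat) (b : nat -> R).

Definition tgrid := (W ^ p.+1)%N.
Definition nsamp := (W ^ (3 * p).+3)%N.
Definition ugrid := (n * tgrid)%N.
Definition ubase := (ugrid + ugrid + 1)%N.
Definition nguess := (ubase ^ (nsamp + nsamp))%N.

Definition gv (g : nat) : R := (g%:R - ugrid%:R) / ugrid%:R.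
(** Multiples of [b j / tgrid] between [- 4 * b j] and [4 * b j]; a value of [v] outside this range
    would cost more than zero does. *)
Definition tv (j l : nat) : R := (l%:R - (4 * tgrid)%:R) * b j / tgrid%:R.
Definition ntv := (8 * tgrid + 1)%N.

Definition cost (u v : nat -> R) : R :=
  \sum_(i < n) \sum_(j < m) (a i j - u i * v j) ^+ p.
Definition colsum (j : nat) : R := \sum_(i < n) a i j ^+ p.
Definition colcost (u : nat -> R) (j : nat) (t : R) : R :=
  \sum_(i < n) (a i j - u i * t) ^+ p.

(* A guess x is a sequence of digits in base ubase: x k for k < nsamp is a sampled
   row and x (nsamp + k) encodes the value of u in this row. A junk row index
   outside the matrix is harmless, its entries being zero. *)
Definition hsel (x : nat -> nat) (j k : nat) : bool :=
  a (x k) j ^+ 2 <= (W%:R * gv (x (nsamp + k)%N) * b j) ^+ 2.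
Definition hterm (x : nat -> nat) (j l k : nat) : R :=
  (a (x k) j / gv (x (nsamp + k)%N) - tv j l) ^+ p.
(** An estimate of the column cost up to the factor [U / nsamp], where [U] is the sum of the
    [u i ^+ p], and up to the share of the large entries. Neither moves the minimum much, so [U]
    does not have to be guessed. *)
Definition hfun (x : nat -> nat) (j l : nat) : R :=
  \sum_(k < nsamp | hsel x j k) hterm x j l k.
Definition vfun (x : nat -> nat) (j : nat) : R := tv j (amin (hfun x j) ntv).
Definition rowcost (v : nat -> R) (i g : nat) : R :=
  \sum_(j < m) (a i j - gv g * v j) ^+ p.
Definition ufun (v : nat -> R) (i : nat) : R := gv (amin (rowcost v i) ubase).
Definition digit (c k : nat) : nat := ((c %/ ubase ^ k) %% ubase)%N.
Definition guess_cost (c : nat) : R :=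
  cost (ufun (vfun (digit c))) (vfun (digit c)).

Hypotheses (p_gt0 : (0 < p)%N) (p_even : ~~ odd p) (n_gt0 : (0 < n)%N).
Hypothesis W_ge4 : (4 <= W)%N.
Hypothesis b_ge0 : forall j, 0 <= b j.
Hypothesis colsum_le : forall j, (j < m)%N -> colsum j <= b j ^+ p.
Hypothesis le_colsum : forall j, (j < m)%N -> b j ^+ p <= 2 ^+ p * colsum j.

Let L_gt0 : (0 < tgrid)%N. Proof. by rewrite expn_gt0; case: W W_ge4. Qed.
Let s_gt0 : (0 < nsamp)%N. Proof. by rewrite expn_gt0; case: W W_ge4. Qed.
Let M_gt0 : (0 < ugrid)%N. Proof. by rewrite muln_gt0 n_gt0. Qed.
Let Wr_gt0 : 0 < W%:R :> R. Proof. by rewrite ltr0n; case: W W_ge4. Qed.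
Let Lr_gt0 : 0 < tgrid%:R :> R. Proof. by rewrite ltr0n. Qed.
Let sr_gt0 : 0 < nsamp%:R :> R. Proof. by rewrite ltr0n. Qed.
Let Mr_gt0 : 0 < ugrid%:R :> R. Proof. by rewrite ltr0n. Qed.
Let pow_ge0 (x : R) : 0 <= x ^+ p. Proof. by rewrite exprn_even_ge0. Qed.

Lemma costE u v : cost u v = \sum_(j < m) colcost u j (v j).
Proof. by rewrite /cost exchange_big. Qed.

Lemma colsum_ge0 j : 0 <= colsum j.
Proof. by apply: sumr_ge0 => i _; exact: pow_ge0. Qed.

Lemma colcost0 u j : colcost u j 0 = colsum j.
Proof. by apply: eq_bigr => i _; rewrite mulr0 subr0. Qed.

Lemma encode_digits (K : nat) (d : nat -> nat) : (forall k, (d k < ubase)%N) ->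
  exists2 c, (c < ubase ^ K)%N & forall k, (k < K)%N -> digit c k = d k.
Proof.
have B0 : (0 < ubase)%N by rewrite /ubase addn1.
elim: K d => [|K IH] d db; first by exists 0%N.
have [c cK cd] := IH (fun k => d k.+1) (fun k => db k.+1).
exists (c * ubase + d 0)%N.
  rewrite expnS; have := db 0%N; move: cK; set X := (ubase ^ K)%N; nia.
move=> [_|k kK]; rewrite /digit.
  by rewrite expn0 divn1 modnMDl modn_small.
by rewrite expnS divnMA divnMDl // (divn_small (db 0%N)) addn0; exact: cd.
Qed.

(** Normalising [u] and cutting [v] off at [4 * b j] confines both to bounded ranges;
    [expr_add_perturb] with parameter [1 / W] then absorbs the rounding errors. Rounding turns the
    norm of [u] from equal to one into at most one. *)
Lemma discretize (u0 v0 : nat -> R) :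
  exists gd ld : nat -> nat,
  [/\ forall i, (gd i < ubase)%N, forall j, (ld j < ntv)%N,
      \sum_(i < n) gv (gd i) ^+ p <= 1 &
      cost (fun i => gv (gd i)) (fun j => tv j (ld j)) <=
        cost u0 v0 + (2 ^+ p + 64 ^+ p) / W%:R * \sum_(j < m) colsum j].
Proof.
have [u1 [v1 [u1n c1]]] : exists u1 v1 : nat -> R, \sum_(i < n) u1 i ^+ p = 1 /\ cost u1 v1 = cost u0 v0.
  pose S := \sum_(i < n) u0 i ^+ p.
  have S0 : 0 <= S by apply: sumr_ge0 => i _; exact: pow_ge0.
  (* A zero [u] cannot be normalised; the first unit vector with [v = 0] gives the same product. *)
  have [SE|Sn] := eqVneq S 0.
    exists (fun i => (i == 0%N)%:R), (fun=> 0); split.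
      case: n n_gt0 => // n' _; rewrite big_ord_recl /= expr1n big1 ?addr0 // => i _.
      by rewrite /= expr0n; case: p p_gt0.
    apply: eq_bigr => i _; apply: eq_bigr => j _; rewrite mulr0.
    have /eqP : u0 i ^+ p = 0 by apply: (psumr_eq0P _ SE).
    by rewrite expf_eq0 p_gt0 /= => /eqP ->; rewrite mul0r.
  pose N := S `^ (p%:R^-1).
  have Sp : 0 < S by rewrite lt_neqAle eq_sym Sn.
  have N0 : 0 < N by apply: powR_gt0.
  have NE : N ^+ p = S.
    by rewrite -powR_mulrn ?ltW // -powRrM mulVf ?powRr1 // pnatr_eq0 -lt0n.
  exists (fun i => u0 i / N), (fun j => v0 j * N); split.
    under eq_bigr do rewrite expr_div_n.
    by rewrite -mulr_suml NE divff.
  apply: eq_bigr => i _; apply: eq_bigr => j _; congr ((_ - _) ^+ _).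
  by field; rewrite gt_eqF.
rewrite -c1 {c1 u0 v0}.
have u1le i : (i < n)%N -> `|u1 i| <= 1.
  move=> ni; rewrite -(@ler_pXn2r _ p) ?nnegrE // expr1n even_expr_norm // -u1n.
  by rewrite (bigD1 (Ordinal ni)) //= lerDl sumr_ge0.
(* Where [v1 j] does worse than zero it is replaced by zero. The column cost is then at most
   [colsum j], and the triangle inequality bounds [v2 j]. *)
pose v2 j := if colcost u1 j (v1 j) <= colsum j then v1 j else 0.
have c2 j : colcost u1 j (v2 j) <= colcost u1 j (v1 j).
  rewrite /v2; case: ifPn => //; rewrite -ltNge colcost0; exact: ltW.
have c2s j : colcost u1 j (v2 j) <= colsum j.
  by rewrite /v2; case: ifPn => // _; rewrite colcost0.
have v2b j : (j < m)%N -> `|v2 j| <= 4 * b j.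
  move=> jm; rewrite -(@ler_pXn2r _ p) ?nnegrE ?mulr_ge0 // even_expr_norm //.
  have -> : v2 j ^+ p = \sum_(i < n) (u1 i * v2 j) ^+ p.
    by under eq_bigr do rewrite exprMn; rewrite -mulr_suml u1n mul1r.
  apply: (@le_trans _ _ (\sum_(i < n) 2 ^+ p * (a i j ^+ p + (a i j - u1 i * v2 j) ^+ p))).
    apply: ler_sum => i _.
    rewrite -(even_expr_norm (_ * _)) // -(even_expr_norm (a i j)) // -(even_expr_norm (_ - _)) //.
    apply: le_trans (exprD_le2 _ _ _) => //.
    rewrite lerXn2r ?nnegrE ?addr_ge0 //.
    rewrite [leLHS](_ : _ = `|a i j - (a i j - u1 i * v2 j)|) ?ler_normB //.
    by congr `|_|; ring.
  rewrite -mulr_sumr big_split /= -/(colsum j) -/(colcost _ _ _) exprMn.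
  have := c2s j; have := colsum_le jm; have := colsum_ge0 j; set z := colcost _ _ _.
  move=> h0 h1 h2.
  rewrite (_ : 4 = 2 * 2) ?exprMn -?mulrA ?ler_wpM2l ?exprn_ge0 //; last by rewrite -natrM.
  have : 2 <= 2 ^+ p :> R by rewrite -[X in X <= _]expr1 ler_weXn2l //; lra.
  have := b_ge0 j; have := pow_ge0 (b j); nra.
have rnd_u i : exists g, (g < ubase)%N /\ ((i < n)%N ->
    `|gv g| <= `|u1 i| /\ `|gv g - u1 i| <= ugrid%:R^-1).
  case: (ltnP i n) => [ni|_]; last by exists 0%N; rewrite /ubase addn1.
  have [|g [g1 g2 g3]] := @round_to_zero _ ugrid (u1 i * ugrid%:R).
    by rewrite normrM (ger0_norm (ltW Mr_gt0)) ler_piMl ?u1le // ltW.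
  exists g; split=> // _; rewrite /gv; split.
    by rewrite normrM normfV (ger0_norm (ltW Mr_gt0)) ler_pdivrMr // -{2}(ger0_norm (ltW Mr_gt0)) -normrM.
  rewrite (_ : _ / _ - _ = (g%:R - ugrid%:R - u1 i * ugrid%:R) / ugrid%:R); last by field; rewrite gt_eqF.
  by rewrite normrM normfV (ger0_norm (ltW Mr_gt0)) ler_pdivrMr // mulVf ?gt_eqF.
have rnd_v j : exists l, (l < ntv)%N /\ ((j < m)%N -> `|tv j l - v2 j| <= b j / tgrid%:R).
  have ntv0 : (0 < ntv)%N by rewrite /ntv addn1.
  case: (ltnP j m) => [jm|_]; last by exists 0%N.
  (* In a column of scale zero [v2 j] is zero and every code yields zero. *)
  have [bj0|bjn] := eqVneq (b j) 0.
    exists 0%N; split=> // _; have := v2b j jm; rewrite /tv bj0 !(mulr0, mul0r) normr_le0 => /eqP ->.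
    by rewrite subrr normr0.
  have bp : 0 < b j by rewrite lt_neqAle eq_sym bjn b_ge0.
  have [|l [l1 l2 l3]] := @round_to_zero _ (4 * tgrid) (v2 j / b j * tgrid%:R).
    rewrite !normrM normfV (ger0_norm (b_ge0 j)) (ger0_norm (ltW Lr_gt0)) natrM.
    by rewrite (ler_wpM2r (ltW Lr_gt0)) // ler_pdivrMr // v2b.
  exists l; split=> [|_]; first by move: l1; rewrite /ntv; lia.
  rewrite /tv (_ : _ - v2 j = (l%:R - (4 * tgrid)%:R - v2 j / b j * tgrid%:R) * (b j / tgrid%:R)).
    have bL : 0 <= b j / tgrid%:R by rewrite divr_ge0 // ltW.
    by rewrite normrM (ger0_norm bL) ler_piMl.
  by field; rewrite bjn gt_eqF.
have [gd gdP] := choice rnd_u; have [ld ldP] := choice rnd_v.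
exists gd, ld; split.
- by move=> i; case: (gdP i).
- by move=> j; case: (ldP j).
- rewrite -u1n; apply: ler_sum => i _; have [_ /(_ (ltn_ord i)) [h _]] := gdP i.
  by rewrite -(even_expr_norm (gv _)) // -(even_expr_norm (u1 i)) // lerXn2r ?nnegrE.
have gsum : \sum_(i < n) gv (gd i) ^+ p <= 1.
  rewrite -u1n; apply: ler_sum => i _; have [_ /(_ (ltn_ord i)) [h _]] := gdP i.
  by rewrite -(even_expr_norm (gv _)) // -(even_expr_norm (u1 i)) // lerXn2r ?nnegrE.
rewrite !costE mulr_sumr -big_split /=; apply: ler_sum => -[j jm] _ /=.
set e := (2 ^+ p + _) / _; set t := tv j (ld j).
apply: (@le_trans _ _ (colcost u1 j (v2 j) + e * colsum j)); last by rewrite lerD2r.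
have [_ /(_ jm) tj] := ldP j.
pose d (i : nat) := u1 i * v2 j - gv (gd i) * t.
have th0 : 0 < W%:R^-1 :> R by rewrite invr_gt0.
have th1 : W%:R^-1 <= 1 :> R by rewrite invf_le1 // ler1n; case: W W_ge4.
have H1 : colcost (fun i => gv (gd i)) j t <=
    (1 + W%:R^-1) ^+ p * colcost u1 j (v2 j) + (1 + W%:R) ^+ p * \sum_(i < n) d i ^+ p.
  rewrite /colcost !mulr_sumr -big_split /=; apply: ler_sum => i _.
  have := @expr_add_perturb R p (a i j - u1 i * v2 j) (d i) _ p_even th0.
  by rewrite invrK /d; congr (_ ^+ _ <= _); ring.
(* The error splits into [gv (gd i) * (v2 j - t)] and [(u1 i - gv (gd i)) * v2 j]. The [p]-th powers
   of the factors [gv (gd i)] sum to at most one; the second part is at most [4 * b j / ugrid] in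
   each of the [n] rows, which the factor [n] in [ugrid] compensates. *)
have H2 : \sum_(i < n) d i ^+ p <= 2 ^+ p * b j ^+ p * ((1 + 4 ^+ p) / tgrid%:R).
  apply: (@le_trans _ _ (\sum_(i < n) 2 ^+ p * b j ^+ p *
      (gv (gd i) ^+ p / tgrid%:R + 4 ^+ p / ugrid%:R))).
    apply: ler_sum => i _; have [_ /(_ (ltn_ord i)) [h1 h2]] := gdP i.
    rewrite -(even_expr_norm (d i)) //.
    have dle : `|d i| <= b j * (`|gv (gd i)| / tgrid%:R) + b j * (4 / ugrid%:R).
      rewrite (_ : d i = gv (gd i) * (v2 j - t) + (u1 i - gv (gd i)) * v2 j); last by rewrite /d; ring.
      apply: le_trans (ler_normD _ _) _; rewrite !normrM; apply: lerD.
        by rewrite mulrCA ler_wpM2l // distrC.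
      rewrite (_ : b j * _ = ugrid%:R^-1 * (4 * b j)); last by ring.
      by apply: ler_pM => //; [rewrite distrC|exact: v2b].
    apply: (@le_trans _ _ ((b j * (`|gv (gd i)| / tgrid%:R) + b j * (4 / ugrid%:R)) ^+ p)).
      by rewrite lerXn2r ?nnegrE // (le_trans _ dle).
    apply: le_trans (exprD_le2 _ _ _) _.
    - by rewrite mulr_ge0 // divr_ge0 // ltW.
    - by rewrite mulr_ge0 // divr_ge0 // ltW.
    move: (gv (gd i)) => z.
    rewrite -mulrA ler_wpM2l ?exprn_ge0 // !exprMn -mulrDr ler_wpM2l // even_expr_norm //.
    have VX (k : nat) : (0 < k)%N -> k%:R^-1 ^+ p <= k%:R^-1 :> R.
      move=> k0; rewrite exprVn lef_pV2 ?posrE ?exprn_gt0 ?ltr0n //.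
      by rewrite -[X in X <= _]expr1 ler_weXn2l // ler1n.
    by apply: lerD; apply: ler_wpM2l; rewrite ?pow_ge0 ?VX.
  rewrite -mulr_sumr ler_wpM2l ?mulr_ge0 ?exprn_ge0 //.
  rewrite big_split /= -mulr_suml sumr_const card_ord mulrDl lerD //.
    by apply: ler_wpM2r => //; rewrite invr_ge0 ltW.
  rewrite -mulr_natr /ugrid natrM le_eqVlt; apply/orP; left; apply/eqP.
  by field; rewrite !pnatr_eq0 -!lt0n n_gt0 L_gt0.
(* Here 64 is [2 ^ 4 * 4]: a factor 2 each from [1 + W <= 2 * W], from [exprD_le2], from [le_colsum]
   and from [1 + 4 ^+ p <= 2 ^+ p * 4 ^+ p]. *)
have H3 : (1 + W%:R) ^+ p * (2 ^+ p * b j ^+ p * ((1 + 4 ^+ p) / tgrid%:R)) <=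
    64 ^+ p / W%:R * colsum j.
  have hW : (1 + W%:R) ^+ p <= 2 ^+ p * W%:R ^+ p :> R.
    rewrite -exprMn lerXn2r ?nnegrE ?mulr_ge0 ?addr_ge0 //.
    have : 1 <= W%:R :> R by rewrite ler1n; case: W W_ge4.
    lra.
  have hb := le_colsum jm.
  have -> : 64 = 2 * (2 * (2 * (2 * 4))) :> R by rewrite -!natrM.
  rewrite !exprMn /tgrid natrX exprS.
  have h4 : 1 + 4 ^+ p <= 2 ^+ p * 4 ^+ p :> R.
    have : 2 <= 2 ^+ p :> R by rewrite -[X in X <= _]expr1 ler_weXn2l //; lra.
    have : 1 <= 4 ^+ p :> R by apply: exprn_ege1; lra.
    nra.
  apply: (@le_trans _ _ (2 ^+ p * W%:R ^+ p * (2 ^+ p * (2 ^+ p * colsum j) *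
     ((2 ^+ p * 4 ^+ p) / (W%:R * W%:R ^+ p))))).
    have hi : 0 <= (W%:R * W%:R ^+ p)^-1 :> R by rewrite invr_ge0 mulr_ge0 // ltW.
    have q0 k : 0 <= k%:R ^+ p :> R by rewrite exprn_ge0.
    have s4 : 0 <= 1 + 4 ^+ p :> R by rewrite addr_ge0.
    apply: ler_pM; [by []|by rewrite !mulr_ge0|exact: hW|].
    apply: ler_pM; [by rewrite mulr_ge0|by rewrite mulr_ge0|by rewrite ler_wpM2l|].
    by rewrite ler_wpM2r.
  rewrite le_eqVlt; apply/orP; left; apply/eqP; field.
  by rewrite expf_eq0 p_gt0 /= andbb gt_eqF.
have H4 : (1 + W%:R^-1) ^+ p * colcost u1 j (v2 j) <=
    colcost u1 j (v2 j) + 2 ^+ p / W%:R * colsum j.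
  have h := @expr1D_le R p W%:R^-1; rewrite (ltW th0) th1 in h.
  have cc0 : 0 <= colcost u1 j (v2 j) by apply: sumr_ge0.
  have := ler_wpM2r cc0 (h isT).
  have q2 : 0 <= 2 ^+ p / W%:R :> R by rewrite mulr_ge0 // ltW.
  have := ler_wpM2l q2 (c2s j).
  have := mulr_ge0 (ltW th0) cc0.
  nra.
have hW2 : 0 <= (1 + W%:R) ^+ p :> R by rewrite exprn_ge0 // addr_ge0.
have := ler_wpM2l hW2 H2; rewrite /e; lra.
Qed.


Lemma tv_bound j l : (l < ntv)%N -> `|tv j l| <= 4 * b j.
Proof.
move=> ll; rewrite /tv !normrM normfV (ger0_norm (b_ge0 j)) (ger0_norm (ltW Lr_gt0)) ler_pdivrMr //.
rewrite mulrAC ler_wpM2r // ler_norml natrM.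
have : (l <= 8 * tgrid)%N by move: ll; rewrite /ntv addn1 ltnS.
by rewrite -(ler_nat R) natrM => h; have h' := ler0n R l; apply/andP; split; lra.
Qed.

Lemma sample_guess (gd ld : nat -> nat) :
  (forall i, (gd i < ubase)%N) -> (forall j, (ld j < ntv)%N) ->
  \sum_(i < n) gv (gd i) ^+ p <= 1 ->
  exists2 c, (c < nguess)%N &
    cost (fun i => gv (gd i)) (vfun (digit c)) <=
    cost (fun i => gv (gd i)) (fun j => tv j (ld j)) +
    (9 * 2 ^+ p + 9 * 8 ^+ p) / W%:R * \sum_(j < m) colsum j.
Proof.
move=> gdb ldb; set U := \sum_(i < n) _ => U1; pose u i := gv (gd i).
have colT : 0 <= \sum_(j < m) colsum j by apply: sumr_ge0 => j _; exact: colsum_ge0.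
have U0 : 0 <= U by apply: sumr_ge0 => i _; exact: pow_ge0.
(* If [u] vanishes, all [v] cost the same and any guess will do. *)
have [UE|Un] := eqVneq U 0.
  exists 0%N; first by rewrite expn_gt0 /ubase addn1.
  rewrite -[leLHS]addr0 lerD //; last first.
    by rewrite mulr_ge0 // mulr_ge0 ?invr_ge0 ?ltW // addr_ge0 // mulr_ge0 // exprn_ge0.
  rewrite le_eqVlt; apply/orP; left; apply/eqP.
  apply: eq_bigr => i _; apply: eq_bigr => j _.
  have /eqP : gv (gd i) ^+ p = 0 by apply: (psumr_eq0P _ UE).
  by rewrite expf_eq0 p_gt0 /= => /eqP ->; rewrite !mul0r.
have Up : 0 < U by rewrite lt_neqAle eq_sym Un.
pose sel j i := a i j ^+ 2 <= (W%:R * u i * b j) ^+ 2.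
pose phi j l i := if sel j i then (a i j / u i - tv j l) ^+ p else 0.
(* For a selected entry [|a i j / u i| <= W * b j], while [|tv j l| <= 4 * b j]. The weight [w j]
   makes [w j * bd j ^+ 2] a multiple of [b j ^+ p], whose sum over the columns is controlled by the
   norm of the matrix whatever [m] is. For [b j = 0] both sides are zero, the inverse of zero being
   zero. *)
pose bd j := ((W%:R + 4) * b j) ^+ p.
pose w j := (b j ^+ p)^-1.
pose q (i : 'I_n) := u i ^+ p / U.
have selP j i : sel j i = (`|a i j| <= W%:R * `|u i| * b j).
  rewrite /sel -(real_normK (num_real (a i j))) -(real_normK (num_real (_ * _))) !normrM.
  by rewrite (ger0_norm (ltW Wr_gt0)) (ger0_norm (b_ge0 j)) ler_pXn2r ?nnegrE // !mulr_ge0 // ltW.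
have phib j l i : (l < ntv)%N -> 0 <= phi j l i <= bd j.
  move=> ll; rewrite /phi /bd; case: ifPn => [|_]; last by rewrite lexx pow_ge0.
  rewrite selP pow_ge0 /= => sl; rewrite -(even_expr_norm (_ - _)) //.
  rewrite lerXn2r ?nnegrE // ?mulr_ge0 ?addr_ge0 //.
  rewrite (le_trans (ler_normB _ _)) // mulrDl lerD ?tv_bound // normrM normfV.
  have [->|u0] := eqVneq (u i) 0; first by rewrite normr0 invr0 mulr0 mulr_ge0 // ltW.
  by rewrite ler_pdivrMr ?normr_gt0 // mulrAC.
(* The family is indexed by pairs of a column and a grid value, so that one choice of rows handles
   all of them. *)
have [||||f [fn fS]] := @greedy_sampling R ('I_m * 'I_ntv)%type n (fun c => w c.1) q
   (fun c => phi c.1 c.2) (fun c => bd c.1) _ _ _ _ nsamp.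
- by move=> c; rewrite invr_ge0 exprn_ge0.
- by move=> i; rewrite divr_ge0.
- by rewrite -mulr_suml divff.
- by move=> c i; apply: phib.
pose mu j l := \sum_i q i * phi j l i.
pose S j l := \sum_(k < nsamp) phi j l (f k) - nsamp%:R * mu j l.
pose x k := if (k < nsamp)%N then f k else gd (f (k - nsamp)%N).
have [|c cb cx] := @encode_digits (nsamp + nsamp) x.
  move=> k; rewrite /x; case: ifP => // _; apply: leq_trans (fn k) _.
  by apply: (@leq_trans ugrid); [exact: leq_pmulr|rewrite /ubase -addnA leq_addr].
exists c => //.
have hE j l : hfun (digit c) j l = \sum_(k < nsamp) phi j l (f k).
  rewrite /hfun big_mkcond /=; apply: eq_bigr => k _.
  have ks := ltn_ord k.
  rewrite /hsel /hterm !cx ?ltn_add2l //; last by rewrite ltn_addl.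
  by rewrite /x ks ltnNge leq_addr /= addKn.
have fS' : \sum_(j < m) \sum_(l < ntv) w j * S j l ^+ 2 <=
   nsamp%:R * (ntv%:R * (W%:R + 4) ^+ (2 * p) * \sum_(j < m) b j ^+ p).
  rewrite pair_bigA /=; apply: le_trans fS _; rewrite ler_wpM2l //.
  rewrite -(pair_bigA _ (fun (j : 'I_m) (l : 'I_ntv) => w j * bd j ^+ 2)) /= mulr_sumr.
  apply: ler_sum => j _; rewrite sumr_const card_ord -[leLHS]mulr_natl -[leRHS]mulrA.
  apply: ler_wpM2l => //.
  rewrite /w /bd !exprMn -exprM mulnC mulrCA ler_wpM2l ?exprn_ge0 ?addr_ge0 //.
  have [->|bn] := eqVneq (b j ^+ p) 0; first by rewrite expr2 mulr0 mulr0.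
  by rewrite expr2 mulrA mulVf // mul1r.
(* Entries outside sel are so large that subtracting u i * t changes their
   p-th power by a factor of at most 1 + O(1 / W). *)
pose rest j := \sum_(i < n | ~~ sel j i) a i j ^+ p.
have approx j l : (l < ntv)%N ->
    `|colcost u j (tv j l) - (U * mu j l + rest j)| <= 4 * 2 ^+ p / W%:R * colsum j.
  move=> ll.
  have UmuE : U * mu j l = \sum_(i < n | sel j i) (a i j - u i * tv j l) ^+ p.
    rewrite /mu mulr_sumr [RHS]big_mkcond /=; apply: eq_bigr => i _.
    rewrite /q /phi; case: ifPn => sl; last by rewrite !mulr0.
    rewrite mulrA mulrCA divff // mulr1 -exprMn; congr (_ ^+ _).
    (* Selection forces [a i j = 0] when [u i = 0], so the division by zero is harmless. *)
    have [ui0|uin] := eqVneq (u i) 0; last by field.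
    by move: sl; rewrite selP ui0 normr0 mulr0 mul0r normr_le0 => /eqP ->; rewrite !mul0r subr0.
  rewrite /colcost (bigID (fun i : 'I_n => sel j i)) /= UmuE /rest.
  rewrite opprD addrACA subrr add0r -sumrB.
  apply: le_trans (ler_norm_sum _ _ _) _.
  apply: (@le_trans _ _ (\sum_(i < n | ~~ sel j i) 4 * 2 ^+ p / W%:R * a i j ^+ p)).
    apply: ler_sum => i; rewrite selP -ltNge => sl.
    rewrite (_ : 4 * 2 ^+ p / W%:R = 2 ^+ p * (4 / W%:R)); last by ring.
    apply: expr_relative_perturb => //.
      by rewrite divr_ge0 ?(ltW Wr_gt0) //= ler_pdivrMr // mul1r -[4]/(4%:R) ler_nat.
    rewrite normrM mulrAC ler_pdivlMr // mulrC.
    have := ler_wpM2l (normr_ge0 (u i)) (tv_bound j ll).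
    move/(ler_wpM2l (ltW Wr_gt0)); move: sl; nra.
  rewrite -mulr_sumr ler_wpM2l ?mulr_ge0 ?invr_ge0 ?exprn_ge0 //.
  by rewrite /colsum [leRHS](bigID (fun i : 'I_n => sel j i)) /= lerDr sumr_ge0.
(* Since [lh] minimises the sampled sum, the true means at [lh] and [ld j] can be in the wrong order
   only by the sampling errors [S] at these two values. Passing between costs and means uses
   [approx] twice, whence [8 * 2 ^+ p]. *)
have col j : (j < m)%N -> colcost u j (vfun (digit c) j) <=
    colcost u j (tv j (ld j)) + 8 * 2 ^+ p / W%:R * colsum j +
    (b j ^+ p / W%:R + W%:R / nsamp%:R ^+ 2 * \sum_(l < ntv) w j * S j l ^+ 2).
  move=> jm; rewrite /vfun; set lh := amin _ _.
  have ntv0 : (0 < ntv)%N by rewrite /ntv addn1.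
  have lhb : (lh < ntv)%N by apply: amin_lt.
  have : hfun (digit c) j lh <= hfun (digit c) j (ld j) by apply: amin_le.
  rewrite !hE => hle.
  have := approx j _ lhb; have := approx j _ (ldb j).
  rewrite !ler_norml => /andP[A1 A2] /andP[A3 A4].
  suff H : U * mu j lh - U * mu j (ld j) <= b j ^+ p / W%:R +
      W%:R / nsamp%:R ^+ 2 * \sum_(l < ntv) w j * S j l ^+ 2 by lra.
  have mle : mu j lh - mu j (ld j) <= (S j (ld j) - S j lh) / nsamp%:R.
    by rewrite ler_pdivlMr //; rewrite /S; lra.
  have w0 : 0 <= w j by rewrite invr_ge0 exprn_ge0.
  have bp0 := pow_ge0 (b j).
  have Vi : 0 <= W%:R^-1 :> R by rewrite invr_ge0.
  have k0 : 0 <= W%:R / nsamp%:R ^+ 2 :> R by rewrite mulr_ge0 ?invr_ge0 ?exprn_ge0.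
  have rhs0 : 0 <= b j ^+ p / W%:R + W%:R / nsamp%:R ^+ 2 * \sum_(l < ntv) w j * S j l ^+ 2.
    apply: addr_ge0; apply: mulr_ge0 => //.
    by apply: sumr_ge0 => l _; rewrite mulr_ge0 // sqr_ge0.
  have [d0|d0] := lerP (mu j lh - mu j (ld j)) 0.
    by apply: le_trans rhs0; rewrite -mulrBr mulr_ge0_le0.
  rewrite -mulrBr (@le_trans _ _ (mu j lh - mu j (ld j))) //.
    by rewrite ler_piMl // ltW.
  apply: le_trans mle _.
  (* The two squared errors must be distinct terms of the sum over [l]. *)
  have lne : lh != ld j by apply: contraTneq d0 => ->; rewrite subrr ltxx.
  have Sb : w j * S j (ld j) ^+ 2 + w j * S j lh ^+ 2 <= \sum_(l < ntv) w j * S j l ^+ 2.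
    rewrite (bigD1 (Ordinal (ldb j))) //= lerD2l (bigD1 (Ordinal lhb)) //= lerDl sumr_ge0 // => l _.
    by rewrite mulr_ge0 // sqr_ge0.
  have := ler_wpM2l k0 Sb.
  set Q := \sum_(l < ntv) _ => QQ.
  suff AG : (S j (ld j) - S j lh) / nsamp%:R <=
     b j ^+ p / W%:R + W%:R / nsamp%:R ^+ 2 * (w j * S j (ld j) ^+ 2 + w j * S j lh ^+ 2) by lra.
  have [bz|bn] := eqVneq (b j) 0.
    have phz l i : (l < ntv)%N -> phi j l i = 0.
      move=> ll; have := phib j l i ll; rewrite /bd bz mulr0 expr0n.
      by rewrite (gtn_eqF p_gt0) /= => /andP[h1 h2]; apply/eqP; rewrite eq_le h1 h2.
    have Sz l : (l < ntv)%N -> S j l = 0.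
      by move=> ll; rewrite /S /mu !big1 ?mulr0 ?subrr // => i _; rewrite phz ?mulr0.
    rewrite !Sz // subrr mul0r; apply: addr_ge0; first exact: mulr_ge0.
    by rewrite expr0n !mulr0 addr0 mulr0.
  have bpp : 0 < b j ^+ p by rewrite exprn_gt0 // lt_neqAle eq_sym bn b_ge0.
  (* AM-GM *)
  have am (y : R) : `|y| / nsamp%:R <= b j ^+ p / W%:R / 2 + W%:R / nsamp%:R ^+ 2 * (w j * y ^+ 2).
    pose z := `|y| / nsamp%:R * W%:R / b j ^+ p.
    have zz : 0 <= (b j ^+ p / W%:R) * (z - 2^-1) ^+ 2.
      by rewrite mulr_ge0 ?sqr_ge0 // mulr_ge0.
    have c1 : b j ^+ p / W%:R * z = `|y| / nsamp%:R by rewrite /z; field; rewrite !gt_eqF.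
    have c2 : b j ^+ p / W%:R * z ^+ 2 = W%:R / nsamp%:R ^+ 2 * (w j * y ^+ 2).
      by rewrite /z /w -(real_normK (num_real y)); field; rewrite !gt_eqF.
    rewrite -c1 -c2; move: zz; set B' := b j ^+ p / W%:R.
    have : 0 <= B' by exact: mulr_ge0.
    by move=> *; nra.
  have := am (S j (ld j)); have := am (S j lh).
  have n1 : S j (ld j) / nsamp%:R <= `|S j (ld j)| / nsamp%:R.
    by rewrite ler_wpM2r ?invr_ge0 ?(ltW sr_gt0) // ler_norm.
  have n2 : - S j lh / nsamp%:R <= `|S j lh| / nsamp%:R.
    by rewrite ler_wpM2r ?invr_ge0 ?(ltW sr_gt0) // -normrN ler_norm.
  by clear -n1 n2; lra.
rewrite !costE; apply: le_trans (ler_sum _ (fun (j : 'I_m) _ => col j (ltn_ord j))) _.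
rewrite !big_split /= -!mulr_sumr -mulr_suml -addrA lerD2l.
have Sb : \sum_(j < m) b j ^+ p <= 2 ^+ p * \sum_(j < m) colsum j.
  by rewrite mulr_sumr; apply: ler_sum => j _; exact: le_colsum.
have k0 : 0 <= W%:R / nsamp%:R ^+ 2 :> R by rewrite mulr_ge0 ?invr_ge0 ?exprn_ge0.
have := ler_wpM2l k0 fS'.
set Q := \sum_(j < m) \sum_(l < ntv) _; set Bt := \sum_(j < m) b j ^+ p in Sb *; set C := \sum_(j < m) _ in Sb colT *.
move=> hQ.
have Bt0 : 0 <= Bt by apply: sumr_ge0.
(* This inequality dictates [nsamp]: one [W] from AM-GM, [9 * W ^+ p.+1] bounding the number of grid
   values, [4 ^+ p * W ^+ (2 * p)] bounding the squares, and one more [W] for the accuracy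
   [1 / W]. *)
have E : W%:R / nsamp%:R ^+ 2 * (nsamp%:R * (ntv%:R * (W%:R + 4) ^+ (2 * p) * Bt)) <=
    9 * 4 ^+ p / W%:R * Bt.
  rewrite [leLHS](_ : _ = W%:R / nsamp%:R * (ntv%:R * (W%:R + 4) ^+ (2 * p)) * Bt); last first.
    by field; rewrite gt_eqF.
  rewrite ler_wpM2r // mulrAC ler_pdivrMr // mulrAC ler_pdivlMr //.
  have h1 : ntv%:R <= 9 * W%:R ^+ p.+1 :> R.
    by rewrite -natrX -natrM ler_nat -[9%N]/(8 + 1)%N mulnDl mul1n leq_add2l.
  have h2 : (W%:R + 4) ^+ (2 * p) <= 4 ^+ p * W%:R ^+ (2 * p) :> R.
    rewrite (_ : 4 = 2 ^+ 2) -?exprM -?exprMn; last by rewrite -natrX.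
    rewrite lerXn2r ?nnegrE ?mulr_ge0 ?addr_ge0 //.
    have : 4%:R <= W%:R :> R by rewrite ler_nat.
    lra.
  apply: (@le_trans _ _ (W%:R * (9 * W%:R ^+ p.+1 * (4 ^+ p * W%:R ^+ (2 * p))) * W%:R)).
    by rewrite ler_wpM2r ?(ltW Wr_gt0) // ler_wpM2l ?(ltW Wr_gt0) // ler_pM.
  rewrite /nsamp natrX le_eqVlt; apply/orP; left; apply/eqP.
  rewrite (_ : (3 * p).+3 = (p.+1 + 2 * p + 1 + 1)%N); last by clear; lia.
  by rewrite !exprD !expr1; ring.
have hW : 0 <= 9 * 4 ^+ p / W%:R :> R by rewrite !mulr_ge0 ?invr_ge0 ?exprn_ge0.
have hV : 0 <= W%:R^-1 :> R by rewrite invr_ge0 ltW.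
have := ler_wpM2l hW Sb; have := ler_wpM2r hV Sb.
rewrite -[8]/(8%:R) (_ : 8%:R = 4 * 2); last by rewrite -natrM.
by rewrite exprMn; lra.
Qed.

(** The losses of discretisation and sampling add up to at most [20 * 64 ^+ p / W], and
    [20 <= 256 <= 16 ^+ p] because an even positive [p] is at least two; hence [1024 = 16 * 64]. *)
Lemma guess_correct (eps : R) : 1024 ^+ p <= W%:R * eps ->
  forall u0 v0, guess_cost (amin guess_cost nguess) <=
    cost u0 v0 + eps * \sum_(j < m) colsum j.
Proof.
move=> We u0 v0.
have [gd [ld [gdb ldb gs dc]]] := discretize u0 v0.
have [c cb cc] := sample_guess gdb ldb gs.
apply: (le_trans (amin_le _ cb)).
(* For fixed [v] the cost separates over the rows, and [ufun] picks the best code in each of them,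
   [gd i] being one candidate. *)
have rc : guess_cost c <= cost (fun i => gv (gd i)) (vfun (digit c)).
  by apply: ler_sum => i _; exact: (amin_le (rowcost (vfun (digit c)) i) (gdb i)).
have colT : 0 <= \sum_(j < m) colsum j by apply: sumr_ge0 => j _; exact: colsum_ge0.
suff H : (2 ^+ p + 64 ^+ p) / W%:R + (9 * 2 ^+ p + 9 * 8 ^+ p) / W%:R <= eps.
  have := ler_wpM2r colT H; lra.
rewrite -mulrDl ler_pdivrMr // [leRHS]mulrC; apply: le_trans We.
have e (k : nat) : (k <= 64)%N -> k%:R ^+ p <= 64 ^+ p :> R.
  by move=> k64; rewrite lerXn2r ?nnegrE // -[64]/(64%:R) ler_nat.
have := e 2%N isT; have := e 8%N isT.
have -> : 1024 = 16 * 64 :> R by rewrite -natrM.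
rewrite exprMn; have : 256 <= 16 ^+ p :> R.
  rewrite (_ : 256 = 16 ^+ 2); last by rewrite -natrX.
  rewrite ler_weXn2l //; first by lra.
  by case: p p_gt0 p_even => [|[]].
have : 1 <= 64 ^+ p :> R by apply: exprn_ege1; lra.
set x := 64 ^+ p; set y := 16 ^+ p; nra.
Qed.

End Algorithm.

(** * Column norms up to a factor of two, without roots *)

Section Scale.
Variables (R : realType) (n p : nat) (a : nat -> nat -> R).
Hypotheses (p_gt0 : (0 < p)%N) (p_even : ~~ odd p).

Fixpoint halve (C z : R) (k : nat) : R :=
  if k is k'.+1 then
    let y := halve C z k' in if C <= (y / 2) ^+ p then y / 2 else y
  else z.

Definition abs_colsum (j : nat) : R := \sum_(i < n) `|a i j|.
Definition scale (j : nat) : R := halve (colsum n p a j) (abs_colsum j) n.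

(** Either some test has failed, which pins the value to within a factor of two of the root of [C],
    or all [k] steps have halved. *)
Lemma halve_inv C z k : 0 <= z -> 0 <= C -> C <= z ^+ p ->
  [/\ 0 <= halve C z k, C <= halve C z k ^+ p &
      (halve C z k / 2) ^+ p <= C \/ halve C z k = z / 2 ^+ k].
Proof.
move=> z0 C0 Cz; elim: k => [|k [h0 h1 h2]] /=.
  by split=> //; right; rewrite expr0 divr1.
case: ifPn => [h|]; last by rewrite -ltNge => /ltW h; split=> //; left.
split=> //; first by rewrite divr_ge0.
case: h2 => [h2|->]; last by right; rewrite exprSr invfM mulrA.
left; apply: le_trans h2; rewrite lerXn2r ?nnegrE ?divr_ge0 //; lra.
Qed.

Lemma abs_colsum_ge0 j : 0 <= abs_colsum j.
Proof. exact: sumr_ge0. Qed.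

Lemma colsum_root j : exists2 r : R, 0 <= r &
  r ^+ p = colsum n p a j /\ forall i, (i < n)%N -> `|a i j| <= r.
Proof.
have C0 : 0 <= colsum n p a j by apply: sumr_ge0 => i _; rewrite exprn_even_ge0.
have r0 : 0 <= colsum n p a j `^ p%:R^-1 by apply: powR_ge0.
exists (colsum n p a j `^ p%:R^-1) => //.
have rE : (colsum n p a j `^ p%:R^-1) ^+ p = colsum n p a j.
  by rewrite -powR_mulrn // -powRrM mulVf ?powRr1 // pnatr_eq0 -lt0n.
split=> // i ni.
rewrite -(@ler_pXn2r _ p) ?nnegrE // rE even_expr_norm // /colsum (bigD1 (Ordinal ni)) //=.
by rewrite lerDl sumr_ge0 // => k _; rewrite exprn_even_ge0.
Qed.

(** With [r] the [p]-norm, every entry is at most [r], so [r ^+ p] is at most [r ^+ p.-1] times the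
    sum of absolute values; one divides by [r ^+ p.-1]. *)
Lemma colsum_le_abs j : colsum n p a j <= abs_colsum j ^+ p.
Proof.
have [r r0 [rE ra]] := colsum_root j.
rewrite -rE lerXn2r ?nnegrE ?abs_colsum_ge0 //.
have [rz|rn] := eqVneq r 0; first by rewrite rz abs_colsum_ge0.
have rp : 0 < r by rewrite lt_neqAle eq_sym rn.
rewrite -(@ler_pM2r _ (r ^+ p.-1)) ?exprn_gt0 //.
rewrite -exprS prednK // rE mulr_suml; apply: ler_sum => i _.
rewrite -(even_expr_norm (a i j)) // -{1}(prednK p_gt0) exprS ler_wpM2l //.
by rewrite lerXn2r ?nnegrE ?ra.
Qed.

(** The sum of absolute values is at most [n] times the [p]-norm and [n <= 2 ^ n], so [n] halvings
    suffice. *)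
Lemma scaleP j : [/\ 0 <= scale j, colsum n p a j <= scale j ^+ p &
  scale j ^+ p <= 2 ^+ p * colsum n p a j].
Proof.
have C0 : 0 <= colsum n p a j by apply: sumr_ge0 => i _; rewrite exprn_even_ge0.
have [h0 h1 h2] := halve_inv n (abs_colsum_ge0 j) C0 (colsum_le_abs j).
split=> //; rewrite -/(scale j) in h2.
have H : (scale j / 2) ^+ p <= colsum n p a j.
  case: h2 => // ->.
  have [r r0 [rE ra]] := colsum_root j; rewrite -rE.
  rewrite lerXn2r ?nnegrE ?divr_ge0 ?abs_colsum_ge0 ?exprn_ge0 //.
  apply: (@le_trans _ _ (abs_colsum j / 2 ^+ n)).
    by rewrite ler_piMr ?invf_le1 ?divr_ge0 ?abs_colsum_ge0 ?exprn_ge0 //; lra.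
  rewrite ler_pdivrMr ?exprn_gt0 //.
  apply: (@le_trans _ _ (n%:R * r)).
    apply: (@le_trans _ _ (\sum_(i < n) r)); last by rewrite sumr_const card_ord mulr_natl.
    by apply: ler_sum => i _; exact: ra.
  by rewrite mulrC ler_wpM2l // -natrX ler_nat ltnW // ltn_expl.
by move: H; rewrite expr_div_n ler_pdivrMr ?exprn_gt0 // mulrC.
Qed.

End Scale.

(** * Total correctness and running time of programs *)

(** Names of arrays are literals, so the arrays that a command writes and an expression reads are
    computed from the syntax, and non-interference is settled mostly by evaluation. *)
Fixpoint nmods (c : cmd) : seq nat :=
  match c with
  | CSkip | CRSet _ _ _ => [::]
  | CNSet a _ _ | CFlip a _ => [:: a]
  | CSeq c1 c2 | CIf _ c1 c2 => nmods c1 ++ nmods c2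
  | CWhile _ c => nmods c
  end.

Fixpoint rmods (c : cmd) : seq nat :=
  match c with
  | CSkip | CNSet _ _ _ | CFlip _ _ => [::]
  | CRSet a _ _ => [:: a]
  | CSeq c1 c2 | CIf _ c1 c2 => rmods c1 ++ rmods c2
  | CWhile _ c => rmods c
  end.

Fixpoint nvars (e : nexpr) : seq nat :=
  match e with
  | NGet a i => a :: nvars i
  | NAdd e1 e2 | NSub e1 e2 => nvars e1 ++ nvars e2
  | _ => [::]
  end.

Fixpoint rnvars (e : rexpr) : seq nat :=
  match e with
  | REps => [::]
  | REntry i j => nvars i ++ nvars j
  | ROfNat i | RGet _ i => nvars i
  | RAdd e1 e2 | RSub e1 e2 | RMul e1 e2 | RDiv e1 e2 => rnvars e1 ++ rnvars e2
  end.

Fixpoint rrvars (e : rexpr) : seq nat :=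
  match e with
  | RGet a _ => [:: a]
  | RAdd e1 e2 | RSub e1 e2 | RMul e1 e2 | RDiv e1 e2 => rrvars e1 ++ rrvars e2
  | _ => [::]
  end.

Notation nvar v := (NGet v (NConst 0)).

Definition CCount (v : nat) (b : bexpr) (body : cmd) : cmd :=
  CWhile b (CSeq body (CNSet v (NConst 0) (NAdd (nvar v) (NConst 1)))).

Definition CFor (v : nat) (N : nexpr) (body : cmd) : cmd :=
  CSeq (CNSet v (NConst 0) (NConst 0)) (CCount v (BNot (BNLe N (nvar v))) body).

Definition tfor (N T C : nat) : nat := (N * (T + C) + C)%N.

(** Running times are kept in the form [Y ^ k * z], where [Y] will exceed every parameter except the
    number [m] of columns and [z] is 1 or [m.+1]. Only the exponent is tracked, with generous
    slack. *)
Lemma tfor_le Y N T C k z : (2 <= Y)%N -> (0 < k)%N -> (0 < z)%N ->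
  (T <= Y ^ k * z)%N -> (C <= Y)%N -> (tfor N T C <= Y ^ k.+1 * (z * N.+1))%N.
Proof.
move=> Y2 k0 z0 TY CY; rewrite /tfor.
have : (Y <= Y ^ k)%N by rewrite -{1}(expn1 Y) leq_pexp2l // ltnW.
rewrite expnS; set X := (Y ^ k)%N in TY * => YX.
have XzY : (Y <= X * z)%N by apply: leq_trans YX _; rewrite leq_pmulr.
have h : (T + C <= Y * X * z)%N by rewrite -mulnA; nia.
have h2 : (C <= Y * X * z)%N by lia.
by rewrite mulnA mulnS addnC leq_add // mulnC leq_mul2r h orbT.
Qed.

Lemma tfor_leY Y N T C k z : (2 <= Y)%N -> (0 < k)%N -> (0 < z)%N -> (N <= Y)%N ->
  (T <= Y ^ k * z)%N -> (C <= Y)%N -> (tfor N T C <= Y ^ k.+3 * z)%N.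
Proof.
move=> Y2 k0 z0 NY TY CY; apply: (leq_trans (tfor_le N Y2 k0 z0 TY CY)).
rewrite (expnS Y k.+2) (expnS Y k.+1) (mulnC z) !mulnA leq_mul2r; apply/orP; right.
rewrite [(_ * N.+1)%N]mulnC leq_mul2r; apply/orP; right; nia.
Qed.

(** * A program logic with time bounds and framing *)

Section Logic.
Variables (R : realType) (x : input R).
Implicit Types (s : state R) (c : cmd) (Q : state R -> Prop).

Definition agree (nm rm : seq nat) s s' : Prop :=
  (forall a, a \notin nm -> forall i, nmem s' a i = nmem s a i) /\
  (forall a, a \notin rm -> forall i, rmem s' a i = rmem s a i).

Lemma agree_trans nm rm s1 s2 s3 :
  agree nm rm s1 s2 -> agree nm rm s2 s3 -> agree nm rm s1 s3.
Proof.
move=> [n1 r1] [n2 r2]; split=> a am i; first by rewrite n2 ?n1.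
by rewrite r2 ?r1.
Qed.

Lemma agree_sub nm rm nm' rm' s1 s2 : {subset nm <= nm'} -> {subset rm <= rm'} ->
  agree nm rm s1 s2 -> agree nm' rm' s1 s2.
Proof.
move=> sn sr [n1 r1]; split=> a am i.
  by apply: n1; apply: contra am; exact: sn.
by apply: r1; apply: contra am; exact: sr.
Qed.

Lemma agree_nset nm rm s a i v : a \in nm -> agree nm rm s (nset s a i v).
Proof.
move=> am; split=> // a' a'm k /=; rewrite /upd; case: eqP => // ea.
by rewrite ea am in a'm.
Qed.

Lemma agree_rset nm rm s a i v : a \in rm -> agree nm rm s (rset s a i v).
Proof.
move=> am; split=> // a' a'm k /=; rewrite /upd; case: eqP => // ea.
by rewrite ea am in a'm.
Qed.

Lemma neval_agree nm rm s s' e : agree nm rm s s' ->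
  ~~ has (mem nm) (nvars e) -> neval x s' e = neval x s e.
Proof.
move=> ag; elim: e => //=.
- by move=> a i IH; rewrite negb_or => /andP[h1 h2]; rewrite IH // ag.1.
- by move=> e1 IH1 e2 IH2; rewrite has_cat negb_or => /andP[h1 h2]; rewrite IH1 ?IH2.
- by move=> e1 IH1 e2 IH2; rewrite has_cat negb_or => /andP[h1 h2]; rewrite IH1 ?IH2.
Qed.

Lemma reval_agree nm rm s s' e : agree nm rm s s' ->
  ~~ has (mem nm) (rnvars e) -> ~~ has (mem rm) (rrvars e) -> reval x s' e = reval x s e.
Proof.
move=> ag; elim: e => //=.
- move=> i j; rewrite has_cat negb_or => /andP[h1 h2] _.
  by rewrite !(neval_agree ag).
- by move=> i h _; rewrite (neval_agree ag).
- by move=> a i h; rewrite orbF => h2; rewrite (neval_agree ag) // ag.2.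
- by move=> e1 IH1 e2 IH2; rewrite !has_cat !negb_or => /andP[h1 h2] /andP[h3 h4]; rewrite IH1 ?IH2.
- by move=> e1 IH1 e2 IH2; rewrite !has_cat !negb_or => /andP[h1 h2] /andP[h3 h4]; rewrite IH1 ?IH2.
- by move=> e1 IH1 e2 IH2; rewrite !has_cat !negb_or => /andP[h1 h2] /andP[h3 h4]; rewrite IH1 ?IH2.
- by move=> e1 IH1 e2 IH2; rewrite !has_cat !negb_or => /andP[h1 h2] /andP[h3 h4]; rewrite IH1 ?IH2.
Qed.

Lemma exec_agree c s t s' : exec x c s t s' -> agree (nmods c) (rmods c) s s'.
Proof.
elim=> {c s t s'} //=.
- by move=> s a i e; apply: agree_nset; rewrite inE.
- by move=> s a i e; apply: agree_rset; rewrite inE.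
- move=> s a i b w _; split=> // a' am k /=; rewrite /upd.
  by move: am; rewrite inE => /negbTE ->.
- move=> c1 c2 s1 s2 s3 t1 t2 _ h1 _ h2.
  apply: (@agree_trans _ _ _ s2).
    by apply: agree_sub h1 => a h; rewrite mem_cat h.
  by apply: agree_sub h2 => a h; rewrite mem_cat h orbT.
- by move=> b c1 c2 s s' t _ _; apply: agree_sub => a h; rewrite mem_cat h.
- by move=> b c1 c2 s s' t _ _; apply: agree_sub => a h; rewrite mem_cat h orbT.
- by move=> b c s1 s2 s3 t1 t2 _ _ h1 _ h2; apply: agree_trans h2.
Qed.

Definition runs c s (T : nat) Q : Prop :=
  exists t s', [/\ (t <= T)%N, exec x c s t s' & Q s'].

Lemma runs_le c s T T' Q : runs c s T Q -> (T <= T')%N -> runs c s T' Q.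
Proof. by move=> [t [s' [h1 h2 h3]]] h; exists t, s'; split=> //; exact: leq_trans h. Qed.

(** The consequence rule also supplies the frame: arrays that [c] does not write are unchanged. *)
Lemma runs_imp c s T Q Q' : runs c s T Q ->
  (forall s', agree (nmods c) (rmods c) s s' -> Q s' -> Q' s') -> runs c s T Q'.
Proof.
move=> [t [s' [h1 h2 h3]]] h; exists t, s'; split=> //.
by apply: h => //; exact: exec_agree h2.
Qed.

Lemma runs_skip s Q : Q s -> runs CSkip s 1 Q.
Proof. by move=> q; exists 1%N, s; split=> //; exact: exec_skip. Qed.

Lemma runs_nset a i e s Q : Q (nset s a (neval x s i) (neval x s e)) ->
  runs (CNSet a i e) s (ncost i + ncost e).+1 Q.
Proof. by move=> q; do 2 eexists; split; [exact: leqnn|exact: exec_nset|]. Qed.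

Lemma runs_rset a i e s Q : Q (rset s a (neval x s i) (reval x s e)) ->
  runs (CRSet a i e) s (ncost i + rcost e).+1 Q.
Proof. by move=> q; do 2 eexists; split; [exact: leqnn|exact: exec_rset|]. Qed.

Lemma runs_seq c1 c2 s T1 T2 Q1 Q : runs c1 s T1 Q1 ->
  (forall s1, agree (nmods c1) (rmods c1) s s1 -> Q1 s1 -> runs c2 s1 T2 Q) ->
  runs (CSeq c1 c2) s (T1 + T2) Q.
Proof.
move=> [t1 [s1 [h1 e1 q1]]] h; have [t2 [s2 [h2 e2 q2]]] := h s1 (exec_agree e1) q1.
by exists (t1 + t2)%N, s2; split=> //; [exact: leq_add|apply: exec_seq e1 e2].
Qed.

Lemma runs_if b c1 c2 s T Q :
  (beval x s b -> runs c1 s T Q) -> (~~ beval x s b -> runs c2 s T Q) ->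
  runs (CIf b c1 c2) s (bcost b + T).+1 Q.
Proof.
move=> h1 h2; have [bT|bF] := boolP (beval x s b).
  have [t [s' [l e q]]] := h1 bT; exists (bcost b + t).+1, s'; split=> //.
    by rewrite ltnS leq_add2l.
  exact: exec_if_true.
have [t [s' [l e q]]] := h2 bF; exists (bcost b + t).+1, s'; split=> //.
  by rewrite ltnS leq_add2l.
exact: exec_if_false.
Qed.

(** Induction on the number of rounds left. The guard is arbitrary as long as the invariant makes it
    equivalent to [i < N0], so the rule covers searches and divisions as well as for loops. The
    invariant is demanded after the increment of the counter, which the body does not perform
    itself. *)
Lemma count_rule v b body s T N0 (I : nat -> state R -> Prop) :
  v \notin nmods body -> nmem s v 0 = 0%N -> I 0%N s ->
  (forall i s', (i <= N0)%N -> agree (v :: nmods body) (rmods body) s s' ->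
     nmem s' v 0 = i -> I i s' -> beval x s' b = (i < N0)%N) ->
  (forall i s', (i < N0)%N -> agree (v :: nmods body) (rmods body) s s' ->
     nmem s' v 0 = i -> I i s' ->
     runs body s' T (fun s'' => I i.+1 (nset s'' v 0 i.+1))) ->
  runs (CCount v b body) s (N0 * (T + bcost b + 7) + bcost b + 1) (I N0).
Proof.
move=> vb v0 I0 hb hbody.
suff H k : (k <= N0)%N -> forall s', agree (v :: nmods body) (rmods body) s s' ->
    nmem s' v 0 = (N0 - k)%N -> I (N0 - k)%N s' ->
    runs (CCount v b body) s' (k * (T + bcost b + 7) + bcost b + 1) (I N0).
  by apply: (H N0); rewrite ?subnn.
elim: k => [|k IH] kN s' ag vs Is.
  rewrite subn0 in vs Is; exists (bcost b).+1, s'; split=> //; first by lia.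
  by apply: exec_while_false; rewrite (hb N0) ?ltnn.
have lt : (N0 - k.+1 < N0)%N by lia.
have [t1 [s1 [l1 e1 I1]]] := hbody _ s' lt ag vs Is.
have ag1 := exec_agree e1.
have v1 : nmem s1 v 0 = (N0 - k.+1)%N by rewrite ag1.1.
have E : ((N0 - k.+1).+1 = N0 - k)%N by lia.
rewrite E in I1.
have [||||t2 [s2 [l2 e2 I2]]] := IH _ (nset s1 v 0 (N0 - k)%N).
- by lia.
- apply: (agree_trans ag); apply: (@agree_trans _ _ _ s1).
    by apply: agree_sub ag1 => a h //; rewrite inE h orbT.
  by apply: agree_nset; rewrite inE eqxx.
- by rewrite /= /upd !eqxx.
- by [].
(* The increment of the counter takes six steps. *)
exists (bcost b + (t1 + 6) + t2).+1, s2; split=> //; first by rewrite mulSn; lia.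
apply: exec_while_true e2; first by rewrite (hb (N0 - k.+1)%N) // leq_subr.
apply: exec_seq e1 _.
have -> : (N0 - k)%N = neval x s1 (NAdd (nvar v) (NConst 1)) by rewrite -E /= v1; lia.
exact: (exec_nset x s1 v (NConst 0) (NAdd (nvar v) (NConst 1))).
Qed.

(** The bound [N] is evaluated again before each round, hence the condition that neither the counter
    nor the body writes to an array it reads. *)
Lemma for_rule v N body s T N0 (I : nat -> state R -> Prop) :
  v \notin nmods body -> neval x s N = N0 -> ~~ has (mem (v :: nmods body)) (nvars N) ->
  I 0%N (nset s v 0 0) ->
  (forall i s', (i < N0)%N -> agree (v :: nmods body) (rmods body) s s' ->
     nmem s' v 0 = i -> I i s' ->
     runs body s' T (fun s'' => I i.+1 (nset s'' v 0 i.+1))) ->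
  runs (CFor v N body) s (tfor N0 T (ncost N + 12)) (I N0).
Proof.
move=> vb NE Nv I0 hbody.
have ag0 : agree (v :: nmods body) (rmods body) s (nset s v 0 0).
  by apply: agree_nset; rewrite inE eqxx.
eapply runs_le.
  eapply (@runs_seq _ _ _ _ _ (fun s1 => s1 = nset s v 0 0)); first exact: runs_nset.
  move=> s1 _ ->; apply: (count_rule (T := T) (N0 := N0) (I := I)) => //.
  - by rewrite /= /upd !eqxx.
  - move=> i s' iN ag vs _ /=; rewrite vs (neval_agree (agree_trans ag0 ag)) // NE.
    by rewrite -ltnNge.
  - by move=> i s' iN ag vs Is; apply: hbody => //; exact: agree_trans ag.
rewrite /tfor /=; nia.
Qed.

End Logic.

(* Arrays of naturals: 0 W, 1 tgrid, 2 nsamp, 3 ugrid, 4 ubase, 5 nguess,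
   6 current guess, 7 its digits, 8 and 9 the division that computes them,
   10 to 14 loop counters, 15 to 17 minimisers, 18 to 21 powers and products.
   Arrays of reals: 0 and 1 the output, 2 the scales of the columns, 3 powers,
   4 sums, 5 to 7 minima. *)

Definition CRPow (e : rexpr) : cmd :=
  CSeq (CRSet 3 (NConst 0) (ROfNat (NConst 1)))
       (CFor 18 NPower (CRSet 3 (NConst 0) (RMul (RGet 3 (NConst 0)) e))).

(** The accumulator is not reset, so that sums over rows and columns can be nested. *)
Definition CSumIf (v : nat) (N : nexpr) (b : bexpr) (e : rexpr) : cmd :=
  CFor v N (CIf b
    (CSeq (CRPow e) (CRSet 4 (NConst 0) (RAdd (RGet 4 (NConst 0)) (RGet 3 (NConst 0)))))
    CSkip).

(** The body leaves its value in real array 4. The test on the counter singles out the first round,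
    when [best] may hold a value from an earlier use. *)
Definition CArgmin (v : nat) (N : nexpr) (body : cmd) (arg best : nat) : cmd :=
  CFor v N (CSeq body
    (CIf (BAnd (BNLe (NConst 1) (nvar v)) (BRLe (RGet best (NConst 0)) (RGet 4 (NConst 0))))
       CSkip
       (CSeq (CNSet arg (NConst 0) (nvar v)) (CRSet best (NConst 0) (RGet 4 (NConst 0)))))).

(** Naturals can only be added, so a product is a repeated addition, linear in the value of [e2];
    the factors that occur are no larger than the number of guesses. *)
Definition CMul (dst v : nat) (e1 e2 : nexpr) : cmd :=
  CSeq (CNSet dst (NConst 0) (NConst 0))
       (CFor v e2 (CNSet dst (NConst 0) (NAdd (nvar dst) e1))).

Definition CNPow (dst tmp v w : nat) (base e : nexpr) : cmd :=
  CSeq (CNSet dst (NConst 0) (NConst 1))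
       (CFor v e (CSeq (CMul tmp w (nvar dst) base) (CNSet dst (NConst 0) (nvar tmp)))).

(** * Correctness and cost of the program fragments *)

Section Macros.
Variables (R : realType) (x : input R).
Implicit Types (s : state R).
Let p := in_power x.

Lemma rpow_runs e s : 18%N \notin rnvars e -> 3%N \notin rrvars e ->
  runs x (CRPow e) s (tfor p 0 (rcost e + 18))
    (fun s' => rmem s' 3 0 = reval x s e ^+ p).
Proof.
move=> h1 h2; eapply runs_le.
  eapply (@runs_seq _ _ _ _ _ _ _ (fun s1 => rmem s1 3 0 = 1)).
    by apply: runs_rset; rewrite /= /upd !eqxx.
  move=> s1 ag1 r1.
  apply: (@for_rule _ _ _ _ _ s1 _ p (fun i s' => rmem s' 3 0 = reval x s e ^+ i)) => //.
  move=> i s' ip ag vs Is; apply: runs_rset; rewrite /= /upd !eqxx /= Is exprSr; congr (_ * _).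
  have ag' : agree [:: 18%N] [:: 3%N] s s'.
    apply: agree_trans (agree_sub _ _ ag) => //.
    by apply: agree_sub ag1.
  by rewrite (reval_agree x ag') //; rewrite has_sym /= orbF.
rewrite /tfor /=; nia.
Qed.

Lemma sumif_runs v N b e s N0 (bk : nat -> bool) (ek : nat -> R) :
  v != 18%N -> neval x s N = N0 -> ~~ has (mem [:: v; 18%N]) (nvars N) ->
  18%N \notin rnvars e -> 3%N \notin rrvars e ->
  (forall k s', (k < N0)%N -> agree [:: v; 18%N] [:: 3%N; 4%N] s s' -> nmem s' v 0 = k ->
     beval x s' b = bk k /\ reval x s' e = ek k) ->
  runs x (CSumIf v N b e) s
    (tfor N0 (p * (rcost e + 18)) (rcost e + bcost b + ncost N + 70))
    (fun s' => rmem s' 4 0 = rmem s 4 0 + \sum_(k < N0 | bk k) ek k ^+ p).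
Proof.
move=> v18 NE Nv e18 e3 hbe; eapply runs_le.
  apply: (@for_rule _ _ _ _ _ s _ N0
    (fun i s' => rmem s' 4 0 = rmem s 4 0 + \sum_(k < i | bk k) ek k ^+ p)) => //.
  - by rewrite /= !inE !(negbTE v18).
  - apply: contra Nv => /hasP[a ai]; rewrite /= !inE => h; apply/hasP; exists a => //.
    by rewrite /= !inE; move: h; rewrite orbb.
  - by rewrite big_ord0 addr0.
  move=> i s' iN ag vs Is.
  have ag' : agree [:: v; 18%N] [:: 3%N; 4%N] s s'.
    by apply: agree_sub ag => a; rewrite /= !inE //; do ?case: eqP.
  have [bE eE] := hbe i s' iN ag' vs.
  apply: (@runs_if _ _ _ _ _ _ (p * (rcost e + 18) + rcost e + 18 + 8)).
    rewrite bE => bi; eapply runs_le.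
      eapply runs_seq; first exact: rpow_runs.
      move=> s1 ag1 r1; apply: runs_rset; rewrite /= /upd !eqxx /=.
      rewrite r1 eE ag1.2 // Is big_mkcond [in RHS]big_mkcond big_ord_recr /= bi addrA.
      reflexivity.
    by rewrite /tfor /=; lia.
  rewrite bE => bi; eapply runs_le; first apply: runs_skip.
    by rewrite /= Is [in RHS]big_mkcond big_ord_recr /= (negbTE bi) addr0 -big_mkcond.
  by lia.
rewrite /tfor /=; nia.
Qed.

Lemma argmin_runs v N body arg best s T N0 (F : nat -> R) :
  (0 < N0)%N -> neval x s N = N0 -> ~~ has (mem (v :: arg :: nmods body)) (nvars N) ->
  v \notin nmods body -> arg \notin nmods body -> best \notin rmods body ->
  arg != v -> best != 4%N ->
  (forall g s', (g < N0)%N ->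
     agree (v :: arg :: nmods body) (best :: rmods body) s s' -> nmem s' v 0 = g ->
     runs x body s' T (fun s'' => rmem s'' 4 0 = F g)) ->
  runs x (CArgmin v N body arg best) s (tfor N0 T (ncost N + 50))
    (fun s' => nmem s' arg 0 = amin F N0).
Proof.
move=> N00 NE Nv vb ab bb av b4 hbody; eapply runs_le.
  eapply runs_imp.
    apply: (@for_rule _ _ _ _ _ s _ N0
      (fun i s' => (0 < i)%N -> nmem s' arg 0 = amin F i /\ rmem s' best 0 = F (amin F i))) => //.
    - by rewrite /= mem_cat negb_or vb /= inE eq_sym.
    - apply: contra Nv => /hasP[a ai]; rewrite /= !inE mem_cat !inE => h.
      apply/hasP; exists a => //; rewrite /= !inE.
      by case/or3P: h => ->; rewrite ?orbT.
    move=> i s' iN ag vs Is.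
    have ag' : agree (v :: arg :: nmods body) (best :: rmods body) s s'.
      apply: agree_sub ag => a; rewrite /= !(inE, mem_cat); first by case/or3P=> ->; rewrite ?orbT.
      by case/orP=> ->; rewrite ?orbT.
    eapply runs_seq; first exact: hbody vs.
    move=> s1 ag1 F1.
    have v1 : nmem s1 v 0 = i by rewrite ag1.1.
    have a1 : nmem s1 arg 0 = nmem s' arg 0 by rewrite ag1.1.
    have b1 : rmem s1 best 0 = rmem s' best 0 by rewrite ag1.2.
    apply: (@runs_if _ _ _ _ _ _ 10); rewrite /= v1 F1 b1.
      move=> /andP[i0 bF]; eapply runs_le; first apply: runs_skip.
        move=> _ /=; have [h1 h2] := Is i0; rewrite /upd (negbTE av) /= a1 b1.
        by rewrite h2 in bF; rewrite bF h1 h2.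
      by [].
    rewrite negb_and => bF; eapply runs_le.
      eapply (@runs_seq _ _ _ _ _ _ _ (fun s2 => s2 = nset s1 arg 0 i)).
        by apply: runs_nset; rewrite /= v1.
      move=> s2 _ ->; apply: runs_rset => _ /=.
      rewrite /upd /= !eqxx (negbTE av) /= F1.
      case: i iN vs Is v1 F1 bF => [|i] iN vs Is v1 F1 bF /=; first by rewrite lexx.
      by have [h1 h2] := Is isT; rewrite /= h2 /= in bF; rewrite (negbTE bF).
    by [].
  by move=> s' _ /= /(_ N00) [].
rewrite /tfor /=; nia.
Qed.

Lemma mul_runs dst v e1 e2 s :
  dst != v -> ~~ has (mem [:: dst; v]) (nvars e1) -> ~~ has (mem [:: dst; v]) (nvars e2) ->
  runs x (CMul dst v e1 e2) s (neval x s e2 * (ncost e1 + ncost e2 + 20) + ncost e2 + 20)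
    (fun s' => nmem s' dst 0 = (neval x s e1 * neval x s e2)%N).
Proof.
move=> dv h1 h2; eapply runs_le.
  eapply (@runs_seq _ _ _ _ _ _ _ (fun s1 => nmem s1 dst 0 = 0%N)).
    by apply: runs_nset; rewrite /= /upd !eqxx.
  move=> s1 ag1 r1.
  have ag1' : agree [:: dst; v] [::] s s1.
    by apply: agree_sub ag1 => a; rewrite /= !inE // => ->.
  apply: (@for_rule _ _ _ _ _ s1 _ (neval x s e2)
     (fun i s' => nmem s' dst 0 = (neval x s e1 * i)%N)) => //.
  - by rewrite /= inE eq_sym.
  - by rewrite (neval_agree x ag1').
  - apply: contra h2 => /hasP[a ai]; rewrite /= !inE => h; apply/hasP; exists a => //.
    by rewrite /= !inE orbC.
  - by rewrite /= /upd (negbTE dv) /= r1 muln0.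
  move=> i s' iN ag vs Is; apply: runs_nset; rewrite /= /upd !eqxx (negbTE dv) /= Is mulnS addnC.
  have ag' : agree [:: dst; v] [::] s s'.
    by apply: agree_trans ag1' (agree_sub _ _ ag) => // a; rewrite /= !inE orbC.
  by rewrite (neval_agree x ag').
rewrite /tfor /=; nia.
Qed.

Lemma npow_runs dst tmp v w base e s (B E : nat) :
  uniq [:: dst; tmp; v; w] -> ~~ has (mem [:: dst; tmp; v; w]) (nvars base) ->
  ~~ has (mem [:: dst; tmp; v; w]) (nvars e) ->
  neval x s base = B -> neval x s e = E ->
  runs x (CNPow dst tmp v w base e) s
    (E * (B * (ncost base + 22) + ncost base + ncost e + 40) + ncost e + 20)
    (fun s' => nmem s' dst 0 = (B ^ E)%N).
Proof.
rewrite /= !inE !negb_or => /and4P[/and3P[dt dv dw] /andP[tv tw] vw _] h1 h2 BE EE.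
eapply runs_le.
  eapply (@runs_seq _ _ _ _ _ _ _ (fun s1 => nmem s1 dst 0 = 1%N)).
    by apply: runs_nset; rewrite /= /upd !eqxx.
  move=> s1 ag1 r1.
  have ag1' : agree [:: dst; tmp; v; w] [::] s s1.
    by apply: agree_sub ag1 => a; rewrite /= !inE // => ->.
  apply: (@for_rule _ _ _ _ _ s1 _ E
     (fun i s' => nmem s' dst 0 = (B ^ i)%N)) => //.
  - rewrite /= !inE !(eq_sym v) (negbTE tv) (negbTE dv).
    by rewrite [w == v]eq_sym (negbTE vw).
  - by rewrite (neval_agree x ag1').
  - apply: contra h2 => /hasP[a ai]; rewrite /= !inE => h; apply/hasP; exists a => //.
    rewrite /= !inE; move: h.
    by case: (a == dst); case: (a == tmp); case: (a == v); case: (a == w).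
  - by rewrite /= /upd (negbTE dv) /= r1.
  move=> i s' iN ag vs Is.
  have ag' : agree [:: dst; tmp; v; w] [::] s s'.
    apply: agree_trans ag1' (agree_sub _ _ ag) => // a; rewrite /= !inE.
    by case: (a == dst); case: (a == tmp); case: (a == v); case: (a == w).
  have bB : neval x s' base = B by rewrite (neval_agree x ag').
  have M := @mul_runs tmp w (nvar dst) base s' tw.
  rewrite /= bB Is in M.
  eapply runs_seq; first apply: M.
  - by rewrite !inE orbF negb_or dt.
  - apply: contra h1 => /hasP[a ai]; rewrite /= !inE => h; apply/hasP; exists a => //.
    by rewrite /= !inE; case/orP: h => ->; rewrite ?orbT.
  move=> s2 _ /= r2.
  by apply: runs_nset; rewrite /= /upd !eqxx (negbTE dv) /= r2 expnSr.
rewrite /tfor /=; nia.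
Qed.

End Macros.

(** * The program *)

Definition btrue : bexpr := BNLe (NConst 0) (NConst 0).
Definition gexpr (e : nexpr) : rexpr :=
  RDiv (RSub (ROfNat e) (ROfNat (nvar 3))) (ROfNat (nvar 3)).
Definition texpr (l : nexpr) : rexpr :=
  RDiv (RMul (RSub (ROfNat l)
                (ROfNat (NAdd (NAdd (nvar 1) (nvar 1)) (NAdd (nvar 1) (nvar 1)))))
             (RGet 2 (nvar 10)))
       (ROfNat (nvar 1)).
Definition zero_sum : cmd := CRSet 4 (NConst 0) (ROfNat (NConst 0)).

(** Division by [ubase] is repeated subtraction: array 8 ends with the remainder, the next digit,
    and the loop counter in array 9 ends with the quotient. *)
Definition decode : cmd :=
  CSeq (CNSet 8 (NConst 0) (nvar 6))
  (CFor 12 (NAdd (nvar 2) (nvar 2))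
    (CSeq (CNSet 9 (NConst 0) (NConst 0))
    (CSeq (CCount 9 (BNLe (nvar 4) (nvar 8)) (CNSet 8 (NConst 0) (NSub (nvar 8) (nvar 4))))
    (CSeq (CNSet 7 (nvar 12) (nvar 8))
          (CNSet 8 (NConst 0) (nvar 9)))))).

Definition sample_entry : rexpr := REntry (NGet 7 (nvar 12)) (nvar 10).
Definition sample_u : rexpr := gexpr (NGet 7 (NAdd (nvar 2) (nvar 12))).
Definition sample_bound : rexpr :=
  RMul (RMul (ROfNat (nvar 0)) sample_u) (RGet 2 (nvar 10)).

Definition columns : cmd :=
  CFor 10 NCols
    (CSeq (CArgmin 11
      (NAdd (NAdd (NAdd (NAdd (nvar 1) (nvar 1)) (NAdd (nvar 1) (nvar 1)))
                  (NAdd (NAdd (nvar 1) (nvar 1)) (NAdd (nvar 1) (nvar 1)))) (NConst 1))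
      (CSeq zero_sum
        (CSumIf 12 (nvar 2)
          (BRLe (RMul sample_entry sample_entry) (RMul sample_bound sample_bound))
          (RSub (RDiv sample_entry sample_u) (texpr (nvar 11)))))
      15 5)
    (CRSet 1 (nvar 10) (texpr (nvar 15)))).

Definition rows : cmd :=
  CFor 13 NRows
    (CSeq (CArgmin 14 (nvar 4)
      (CSeq zero_sum
        (CSumIf 10 NCols btrue
          (RSub (REntry (nvar 13) (nvar 10)) (RMul (gexpr (nvar 14)) (RGet 1 (nvar 10))))))
      16 6)
    (CRSet 0 (nvar 13) (gexpr (nvar 16)))).

Definition total : cmd :=
  CSeq zero_sum
    (CFor 13 NRows
      (CSumIf 10 NCols btrue
        (RSub (REntry (nvar 13) (nvar 10)) (RMul (RGet 0 (nvar 13)) (RGet 1 (nvar 10)))))).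

Definition try_guess : cmd := CSeq decode (CSeq columns (CSeq rows total)).

(** Reals cannot be converted to naturals, so [W] is found by counting up. *)
Definition compute_W : cmd :=
  CSeq (CRPow (RMul (ROfNat (NConst 32)) (ROfNat (NConst 32))))
  (CSeq (CNSet 0 (NConst 0) (NConst 0))
    (CCount 0 (BNot (BRLe (RGet 3 (NConst 0)) (RMul (ROfNat (nvar 0)) REps))) CSkip)).

Definition compute_scale : cmd :=
  CSeq (CSeq zero_sum (CSumIf 13 NRows btrue (REntry (nvar 13) (nvar 10))))
  (CSeq (CRSet 2 (nvar 10) (ROfNat (NConst 0)))
  (CSeq (CFor 13 NRows
     (CIf (BRLe (ROfNat (NConst 0)) (REntry (nvar 13) (nvar 10)))
       (CRSet 2 (nvar 10) (RAdd (RGet 2 (nvar 10)) (REntry (nvar 13) (nvar 10))))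
       (CRSet 2 (nvar 10) (RSub (RGet 2 (nvar 10)) (REntry (nvar 13) (nvar 10))))))
  (CFor 13 NRows
     (CSeq (CRPow (RDiv (RGet 2 (nvar 10)) (ROfNat (NConst 2))))
     (CIf (BRLe (RGet 4 (NConst 0)) (RGet 3 (NConst 0)))
       (CRSet 2 (nvar 10) (RDiv (RGet 2 (nvar 10)) (ROfNat (NConst 2))))
       CSkip))))).

Definition setup : cmd :=
  CSeq compute_W
  (CSeq (CNPow 1 19 20 21 (nvar 0) (NAdd NPower (NConst 1)))
  (CSeq (CNPow 2 19 20 21 (nvar 0) (NAdd (NAdd NPower (NAdd NPower NPower)) (NConst 3)))
  (CSeq (CMul 3 20 NRows (nvar 1))
  (CSeq (CNSet 4 (NConst 0) (NAdd (NAdd (nvar 3) (nvar 3)) (NConst 1)))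
  (CSeq (CNPow 5 19 20 21 (nvar 4) (NAdd (nvar 2) (nvar 2)))
        (CFor 10 NCols compute_scale)))))).

(** Later guesses overwrite the output arrays, so the best guess is replayed at the end. *)
Definition rank_one_program : cmd :=
  CSeq setup
  (CSeq (CArgmin 6 (nvar 5) try_guess 17 7)
  (CSeq (CNSet 6 (NConst 0) (nvar 17)) try_guess)).

(** * The program returns the cheapest guess *)

Section Correctness.
Variables (R : realType) (x : input R).
Let n := in_rows x.
Let m := in_cols x.
Let p := in_power x.
Let a := entry x.
Variables (W : nat) (b : nat -> R).
Let L := tgrid p W.
Let S := nsamp p W.
Let M := ugrid n p W.
Let B := ubase n p W.
Let P := nguess n p W.
Variable Y : nat.
Hypotheses (Y_big : (200 <= Y)%N) (p3_le : ((3 * p).+3 <= Y)%N) (n_le : (n <= Y)%N) (S_le : (S + S <= Y)%N)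
  (L_le : (ntv p W <= Y)%N) (B_le : (B <= Y)%N) (P_le : (P <= Y)%N) (W_le : (W <= Y)%N).
Implicit Types (s : state R).

Let p_le : (p <= Y)%N. Proof. by move: p3_le; lia. Qed.
Let Y2 : (2 <= Y)%N. Proof. exact: leq_trans Y_big. Qed.
Let cY k : (k <= 200)%N -> (k <= Y)%N. Proof. by move=> h; exact: leq_trans Y_big. Qed.

Let Y_pow k : (0 < k)%N -> (Y <= Y ^ k)%N.
Proof. by move=> k0; rewrite -{1}(expn1 Y) leq_pexp2l // ltnW. Qed.

Let add_pow k z t1 t2 : (t1 <= Y ^ k * z)%N -> (t2 <= Y ^ k * z)%N -> (t1 + t2 <= Y ^ k.+1 * z)%N.
Proof. rewrite expnS -mulnA; nia. Qed.

Let pow_mono k k' z t : (k <= k')%N -> (t <= Y ^ k * z)%N -> (t <= Y ^ k' * z)%N.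
Proof.
move=> kk /leq_trans; apply; rewrite leq_mul2r leq_pexp2l ?orbT //; exact: ltnW.
Qed.

Let const_pow k z t : (0 < k)%N -> (0 < z)%N -> (t <= 200)%N -> (t <= Y ^ k * z)%N.
Proof.
move=> k0 z0 /cY tY; apply: (leq_trans tY); apply: (leq_trans (Y_pow k0)); exact: leq_pmulr.
Qed.

Definition pars s : Prop :=
  [/\ nmem s 0 0 = W, nmem s 1 0 = L, nmem s 2 0 = S, nmem s 3 0 = M & nmem s 4 0 = B] /\
  forall j, (j < m)%N -> rmem s 2 j = b j.

Lemma pars_agree nm rm s s' : agree nm rm s s' ->
  ~~ has (mem nm) [:: 0; 1; 2; 3; 4]%N -> 2%N \notin rm -> pars s -> pars s'.
Proof.
move=> ag hn hr [[p0 p1 p2 p3 p4] pb].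
move: hn; rewrite /= !negb_or => /and5P[h0 h1 h2 h3 /andP[h4 _]].
by split; [split; rewrite ag.1 //|move=> j jm; rewrite ag.2 // pb].
Qed.

Let sum_time N0 r c : (r + c + 70 <= 200)%N ->
  (tfor N0 (p * (r + 18)) (r + c + 70) <= Y ^ 3 * N0.+1)%N.
Proof.
move=> h; have := @tfor_le Y N0 (p * (r + 18)) (r + c + 70) 2 1 Y2 isT isT.
rewrite muln1 mul1n; apply; last exact: cY.
by rewrite -mulnn leq_mul // cY //; lia.
Qed.

Lemma sum_runsY v N c e s N0 (bk : nat -> bool) (ek : nat -> R) :
  v != 18%N -> neval x s N = N0 -> ~~ has (mem [:: v; 18%N]) (nvars N) ->
  18%N \notin rnvars e -> 3%N \notin rrvars e -> (rcost e + bcost c + ncost N + 70 <= 200)%N ->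
  (forall k s', (k < N0)%N -> agree [:: v; 18%N] [:: 3%N; 4%N] s s' -> nmem s' v 0 = k ->
     beval x s' c = bk k /\ reval x s' e = ek k) ->
  runs x (CSeq zero_sum (CSumIf v N c e)) s (Y ^ 4 * N0.+1)
    (fun s' => rmem s' 4 0 = \sum_(k < N0 | bk k) ek k ^+ p).
Proof.
move=> v18 NE Nv e18 e3 cost hbe; eapply runs_le.
  eapply (@runs_seq _ _ _ _ _ _ _ (fun s1 => s1 = rset s 4 0 0)); first exact: runs_rset.
  move=> s1 ag1 s1E; eapply runs_imp.
    apply: (@sumif_runs _ _ v N c e s1 N0 bk ek) => //.
      by rewrite s1E (neval_agree x (@agree_rset _ [::] [:: 4%N] s 4 0 0 isT)) // has_pred0.
    move=> k s' kN ag vs; apply: hbe => //.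
    by apply: agree_trans ag; rewrite s1E; exact: agree_rset.
  by move=> s' _ ->; rewrite s1E /= /upd !eqxx /= add0r.
apply: add_pow; first exact: const_pow.
by rewrite -[(_ + bcost c + _)%N]addnA; apply: sum_time; rewrite addnA.
Qed.

(** The test [B <= y0 - i * B] holds exactly while [i < y0 %/ B], so the number of rounds is the
    quotient. *)
Lemma division_runs s y0 : nmem s 8 0 = y0 -> nmem s 4 0 = B -> nmem s 9 0 = 0%N ->
  runs x (CCount 9 (BNLe (nvar 4) (nvar 8)) (CNSet 8 (NConst 0) (NSub (nvar 8) (nvar 4)))) s
    (y0 * 20 + 20)
    (fun s' => nmem s' 8 0 = (y0 %% B)%N /\ nmem s' 9 0 = (y0 %/ B)%N).
Proof.
move=> y3 B3 q3; have B0 : (0 < B)%N by rewrite /B /ubase addn1.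
eapply runs_le.
  eapply runs_imp.
    apply: (@count_rule _ _ _ _ _ _ 7 (y0 %/ B)
      (fun i s' => nmem s' 8 0 = (y0 - i * B)%N /\ nmem s' 9 0 = i)) => //.
    + by rewrite mul0n subn0.
    + move=> k s5 kN ag5 v5 [y5 _]; rewrite /= y5 ag5.1 // B3.
      by rewrite leq_divRL // in kN; rewrite leq_divRL // mulSn; lia.
    + move=> k s5 kN ag5 v5 [y5 _]; apply: runs_nset; rewrite /= /upd /= y5 ag5.1 // B3.
      by rewrite -subnDA mulSn addnC.
  by move=> s5 _ /= [-> ->]; split=> //; rewrite {1}(divn_eq y0 B) addKn.
by have := leq_div y0 B; rewrite /=; lia.
Qed.

Lemma decode_runs s c : pars s -> nmem s 6 0 = c -> (c < P)%N ->
  runs x decode s (Y ^ 8) (fun s' => forall k, (k < S + S)%N -> nmem s' 7 k = digit n p W c k).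
Proof.
move=> ps c6 cP; eapply runs_le.
  eapply (@runs_seq _ _ _ _ _ _ _ (fun s1 => nmem s1 8 0 = c)).
    by apply: runs_nset; rewrite /= /upd /= c6.
  move=> s1 ag1 y1.
  have ps1 : pars s1 by apply: pars_agree ps; first exact: ag1.
  eapply runs_imp.
    apply: (@for_rule _ _ _ _ _ s1 (Y ^ 3) (S + S) (fun i s' => nmem s' 8 0 = (c %/ B ^ i)%N /\
     forall k, (k < i)%N -> nmem s' 7 k = digit n p W c k)) => //.
    - by rewrite /=; case: ps1 => -[_ _ -> _ _] _.
    - by rewrite /= expn0 divn1; split.
    move=> i s2 iS ag2 v2 [y2 d2].
    have ps2 : pars s2 by apply: pars_agree ps1; first exact: ag2.
    have [[_ _ _ _ B2] _] := ps2.
    set y0 := (c %/ B ^ i)%N in y2.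
    have y0Y : (y0 <= Y)%N by apply: leq_trans P_le; apply: leq_trans (ltnW cP); exact: leq_div.
    eapply runs_le.
      eapply (@runs_seq _ _ _ _ _ _ _ (fun s3 => nmem s3 9 0 = 0%N)).
        by apply: runs_nset; rewrite /= /upd.
      move=> s3 ag3 q3.
      eapply runs_seq.
        by apply: (@division_runs s3 y0); rewrite // ag3.1.
      move=> s4 ag4 [y4 q4].
      have v4 : nmem s4 12 0 = i by rewrite ag4.1 // ag3.1.
      have d4 k : (k < i)%N -> nmem s4 7 k = digit n p W c k.
        by move=> ki; rewrite ag4.1 // ag3.1 // d2.
      eapply (@runs_seq _ _ _ _ _ _ _ (fun s5 => s5 = nset s4 7 i (y0 %% B)%N)).
        by apply: runs_nset; rewrite /= v4 y4.
      move=> s5 _ ->; apply: runs_nset; rewrite /= /upd /=; split.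
        by rewrite q4 /y0 expnSr divnMA.
      move=> k; rewrite ltnS; case: eqP => [-> _|kn ki] //.
      by apply: d4; rewrite ltn_neqAle ki andbT; apply/eqP.
    by rewrite /= !expnS expn0 muln1; nia.
  by move=> s' _ [].
rewrite -[leqRHS]muln1; apply: add_pow; first exact: const_pow.
apply: pow_mono (tfor_leY (k := 3) (z := 1) Y2 _ _ S_le _ _) => //; first by rewrite muln1.
by rewrite /= cY.
Qed.

Definition digits s (c : nat) : Prop :=
  forall k, (k < S + S)%N -> nmem s 7 k = digit n p W c k.

Lemma digits_agree nm rm s s' c : agree nm rm s s' -> 7%N \notin nm -> digits s c -> digits s' c.
Proof. by move=> ag h d k kS; rewrite ag.1 // d. Qed.

Lemma texprE s l j : pars s -> (j < m)%N -> nmem s 10 0 = j ->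
  reval x s (texpr l) = tv p W b j (neval x s l).
Proof.
move=> [[_ p1 _ _ _] pb] jm j10; rewrite /= p1 j10 pb // /tv; congr ((_ - _%:R) * _ / _).
by rewrite /L; lia.
Qed.

Lemma gexprE s e : pars s -> reval x s (gexpr e) = gv R n p W (neval x s e).
Proof. by move=> [[_ _ _ p3 _] _] /=; rewrite p3. Qed.

Let vf c := vfun n p a W b (digit n p W c).
Let uf c := ufun n m p a W (vf c).

Lemma columns_runs s c : pars s -> digits s c ->
  runs x columns s (Y ^ 12 * m.+1) (fun s' => forall j, (j < m)%N -> rmem s' 1 j = vf c j).
Proof.
move=> ps ds; eapply runs_le.
  apply: (@for_rule _ _ _ _ _ s (Y ^ 10) m
    (fun i s' => forall j, (j < i)%N -> rmem s' 1 j = vf c j)) => //.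
  move=> j s1 jm ag1 v1 I1.
  have ps1 : pars s1 by apply: pars_agree ps; first exact: ag1.
  have ds1 : digits s1 c by apply: digits_agree ds; first exact: ag1.
  eapply runs_le.
    eapply runs_seq.
      apply: (@argmin_runs _ _ _ _ _ _ _ s1 (Y ^ 6) (ntv p W) (hfun n p a W b (digit n p W c) j)) => //.
      - by rewrite /ntv addn1.
      - by rewrite /=; case: ps1 => -[_ -> _ _ _] _; rewrite /L /ntv; lia.
      move=> l s2 lN ag2 v2.
      have ps2 : pars s2 by apply: pars_agree ps1; first exact: ag2.
      have ds2 : digits s2 c by apply: digits_agree ds1; first exact: ag2.
      have j2 : nmem s2 10 0 = j by rewrite ag2.1.
      eapply runs_le.
        apply: (@sum_runsY _ _ _ _ s2 S (hsel n p a W b (digit n p W c) j)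
          (fun k => a (digit n p W c k) j / gv R n p W (digit n p W c (S + k)%N) - tv p W b j l)) => //.
          by rewrite /=; case: ps2 => -[].
        move=> k s3 kS ag3 k3.
        have ps3 : pars s3 by apply: pars_agree ps2; first exact: ag3.
        have ds3 : digits s3 c by apply: digits_agree ds2; first exact: ag3.
        have j3 : nmem s3 10 0 = j by rewrite ag3.1.
        have l3 : nmem s3 11 0 = l by rewrite ag3.1.
        have [[W3 _ S3 _ _] b3] := ps3.
        have eE : reval x s3 sample_entry = a (digit n p W c k) j.
          by rewrite /= k3 j3 ds3 // ltn_addl.
        have uE : reval x s3 sample_u = gv R n p W (digit n p W c (S + k)%N).
          by rewrite gexprE // [neval _ _ _]/= S3 k3 ds3 // ltn_add2l.
        have bE : reval x s3 sample_bound = W%:R * gv R n p W (digit n p W c (S + k)%N) * b j.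
          by rewrite -uE /= W3 j3 b3.
        split.
          by rewrite -[beval _ _ _]/(reval x s3 sample_entry * reval x s3 sample_entry <=
            reval x s3 sample_bound * reval x s3 sample_bound) eE bE /hsel !expr2.
        rewrite -[LHS]/(reval x s3 sample_entry / reval x s3 sample_u - reval x s3 (texpr (nvar 11))).
        by rewrite eE uE (texprE _ ps3 jm j3) /= l3.
      have : (S.+1 <= Y)%N by move: S_le Y_big; clear; lia.
      by move=> h; rewrite (expnD Y 4 2) leq_mul2l (leq_trans h) ?orbT // Y_pow.
    move=> s2 ag2 v2.
    have ps2 : pars s2 by apply: pars_agree ps1; first exact: ag2.
    have j2 : nmem s2 10 0 = j by rewrite ag2.1.
    apply: runs_rset => k; rewrite ltnS => kj; rewrite (texprE _ ps2 jm j2).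
    rewrite /= v2 j2 /upd /=.
    case: eqP => [-> //|kn]; rewrite ag2.2 // I1 // ltn_neqAle kj andbT; exact/eqP.
  rewrite -[leqRHS]muln1; apply: add_pow; last exact: const_pow.
  by apply: (tfor_leY (k := 6) (z := 1)) => //; [rewrite muln1|rewrite cY].
have := tfor_le (k := 10) (z := 1) (T := Y ^ 10) m Y2 isT isT.
by rewrite muln1 mul1n => /(_ _ (leqnn _)) h; apply: pow_mono (h _ _) => //; rewrite cY.
Qed.

Definition vcol s c : Prop := forall j, (j < m)%N -> rmem s 1 j = vf c j.
Definition ucol s c : Prop := forall i, (i < n)%N -> rmem s 0 i = uf c i.

Lemma rows_runs s c : pars s -> vcol s c -> runs x rows s (Y ^ 12 * m.+1) (fun s' => ucol s' c).
Proof.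
move=> ps vs; eapply runs_le.
  apply: (@for_rule _ _ _ _ _ s (Y ^ 8 * m.+1) n
    (fun i s' => forall j, (j < i)%N -> rmem s' 0 j = uf c j)) => //.
  move=> i s1 ni ag1 v1 I1.
  have ps1 : pars s1 by apply: pars_agree ps; first exact: ag1.
  have vs1 : vcol s1 c by move=> j jm; rewrite ag1.2 // vs.
  eapply runs_le.
    eapply runs_seq.
      apply: (@argmin_runs _ _ _ _ _ _ _ s1 (Y ^ 4 * m.+1) B (rowcost n m p a W (vf c) i)) => //.
      - by rewrite /B /ubase addn1.
      - by rewrite /=; case: ps1 => -[].
      move=> g s2 gB ag2 v2.
      have ps2 : pars s2 by apply: pars_agree ps1; first exact: ag2.
      have i2 : nmem s2 13 0 = i by rewrite ag2.1.
      have vs2 : vcol s2 c by move=> j jm; rewrite ag2.2 // vs1.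
      apply: (@sum_runsY _ _ _ _ s2 m xpredT (fun j => a i j - gv R n p W g * vf c j)) => //.
      move=> j s3 jm ag3 j3.
      have ps3 : pars s3 by apply: pars_agree ps2; first exact: ag3.
      split=> //.
      rewrite -[LHS]/(entry x (nmem s3 13 0) (nmem s3 10 0) - reval x s3 (gexpr (nvar 14)) * rmem s3 1 (nmem s3 10 0)).
      by rewrite gexprE //= j3 !ag3.1 // ag3.2 // i2 v2 vs2.
    move=> s2 ag2 v2.
    have ps2 : pars s2 by apply: pars_agree ps1; first exact: ag2.
    have i2 : nmem s2 13 0 = i by rewrite ag2.1.
    apply: runs_rset => k; rewrite ltnS => ki; rewrite gexprE //.
    rewrite /= v2 i2 /upd /=.
    case: eqP => [-> //|kn]; rewrite ag2.2 // I1 // ltn_neqAle ki andbT; exact/eqP.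
  apply: add_pow; last exact: const_pow.
  by apply: (tfor_leY (k := 4) (z := m.+1)) => //; rewrite cY.
have := tfor_leY (k := 8) (z := m.+1) (T := Y ^ 8 * m.+1) Y2 isT isT n_le (leqnn _).
by move=> h; apply: pow_mono (h _ _) => //; rewrite cY.
Qed.

Lemma total_runs s c : ucol s c -> vcol s c ->
  runs x total s (Y ^ 10 * m.+1)
    (fun s' => rmem s' 4 0 = guess_cost n m p a W b c).
Proof.
move=> us vs; eapply runs_le.
  eapply (@runs_seq _ _ _ _ _ _ _ (fun s1 => rmem s1 4 0 = 0)).
    by apply: runs_rset; rewrite /= /upd !eqxx.
  move=> s1 ag1 r1.
  have us1 : ucol s1 c by move=> j jm; rewrite ag1.2 // us.
  have vs1 : vcol s1 c by move=> j jm; rewrite ag1.2 // vs.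
  eapply runs_imp.
    apply: (@for_rule _ _ _ _ _ s1 (Y ^ 3 * m.+1) n
      (fun i s' => rmem s' 4 0 = \sum_(i' < i) \sum_(j < m) (a i' j - uf c i' * vf c j) ^+ p)) => //.
    - by rewrite big_ord0.
    move=> i s2 ni ag2 v2 I2.
    have us2 : ucol s2 c by move=> j jm; rewrite ag2.2 // us1.
    have vs2 : vcol s2 c by move=> j jm; rewrite ag2.2 // vs1.
    eapply runs_le.
      eapply runs_imp.
        apply: (@sumif_runs _ _ _ _ _ _ s2 m xpredT (fun j => a i j - uf c i * vf c j)) => //.
        move=> j s3 jm ag3 j3; split=> //=.
        by rewrite j3 !ag3.1 // !ag3.2 // v2 us2 // vs2.
      by move=> s' _ E; rewrite [LHS]/= E I2 big_ord_recr.
    exact: (@sum_time m 13 4).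
  by move=> s' _ ->.
apply: add_pow; first exact: const_pow.
have := tfor_leY (k := 3) (z := m.+1) (T := Y ^ 3 * m.+1) Y2 isT isT n_le (leqnn _).
by move=> h; apply: pow_mono (h _ _) => //; rewrite cY.
Qed.

Lemma try_guess_runs s c : pars s -> nmem s 6 0 = c -> (c < P)%N ->
  runs x try_guess s (Y ^ 15 * m.+1)
    (fun s' => [/\ rmem s' 4 0 = guess_cost n m p a W b c, ucol s' c & vcol s' c]).
Proof.
move=> ps c6 cP; eapply runs_le.
  eapply runs_seq; first exact: decode_runs cP.
  move=> s1 ag1 d1; have ps1 : pars s1 by apply: pars_agree ps; first exact: ag1.
  eapply runs_seq; first exact: columns_runs d1.
  move=> s2 ag2 d2; have ps2 : pars s2 by apply: pars_agree ps1; first exact: ag2.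
  eapply runs_seq; first exact: rows_runs d2.
  move=> s3 ag3 d3.
  have v3 : vcol s3 c by move=> j jm; rewrite ag3.2 // d2.
  eapply runs_imp; first exact: total_runs d3 v3.
  move=> s4 ag4 E; split=> //.
    by move=> i ni; rewrite ag4.2 // d3.
  by move=> j jm; rewrite ag4.2 // v3.
apply: add_pow; first by apply: (@pow_mono 8) => //; rewrite leq_pmulr.
apply: add_pow; first by apply: (@pow_mono 12).
by apply: add_pow; apply: (@pow_mono _ 12 _ _ _ (leqnn _)).
Qed.


Let eps := in_eps x.
Hypothesis b_def : b = scale n p a.
Hypothesis W_large : 1024 ^+ p <= W%:R * eps.
Hypothesis W_min : forall k, (k < W)%N -> ~~ (1024 ^+ p <= k%:R * eps).

(** [W_large] makes the guard fail at [W] and [W_min] makes it hold below, which gives exactly [W]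
    rounds. *)
Lemma compute_W_runs s : runs x compute_W s (Y ^ 6) (fun s' => nmem s' 0 0 = W).
Proof.
eapply runs_le.
  eapply runs_seq; first exact: rpow_runs.
  move=> s1 ag1 r1.
  have {}r1 : rmem s1 3 0 = 1024 ^+ p by rewrite r1 /= -natrM.
  eapply (@runs_seq _ _ _ _ _ _ _ (fun s2 => nmem s2 0 0 = 0%N)).
    by apply: runs_nset; rewrite /= /upd.
  move=> s2 ag2 w2; eapply runs_imp.
    apply: (@count_rule _ _ _ _ _ _ 1 W (fun i s' => nmem s' 0 0 = i)) => //.
      move=> k s3 kW ag3 v3 _; rewrite /= v3 ag3.2 // ag2.2 // r1 -/eps.
      move: kW; rewrite leq_eqVlt => /orP[/eqP ->|kW]; first by rewrite W_large ltnn.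
      by rewrite kW W_min.
    by move=> k s3 kW ag3 v3 _; apply: runs_skip; rewrite /= /upd.
  by [].
rewrite -[leqRHS]muln1; apply: add_pow.
  by apply: pow_mono (tfor_leY (k := 1) (z := 1) Y2 _ _ p_le _ _) => //; rewrite /= cY.
apply: add_pow; first exact: const_pow.
apply: (@pow_mono 2) => //; rewrite muln1 -mulnn /=; nia.
Qed.

(** The second conjunct protects the scales of the other columns, since the frame condition treats
    array 2 as written in its entirety. *)
Lemma compute_scale_runs s j : nmem s 10 0 = j ->
  runs x compute_scale s (Y ^ 12) (fun s' => rmem s' 2 j = scale n p a j /\
     forall k, k != j -> rmem s' 2 k = rmem s 2 k).
Proof.
move=> j0; eapply runs_le.
  eapply runs_seq.
    apply: (@sum_runsY _ _ _ _ s n xpredT (fun i => a i j)) => //.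
    by move=> i s1 ni ag1 v1; split=> //=; rewrite v1 ag1.1 // j0.
  move=> s1 ag1 r1; rewrite -/(colsum n p a j) in r1.
  have j1 : nmem s1 10 0 = j by rewrite ag1.1.
  eapply (@runs_seq _ _ _ _ _ _ _ (fun s2 => s2 = rset s1 2 j 0)).
    by apply: runs_rset; rewrite /= j1.
  move=> s2 ag2 s2E.
  have j2 : nmem s2 10 0 = j by rewrite ag2.1.
  have o2 k : k != j -> rmem s2 2 k = rmem s 2 k.
    by move=> kj; rewrite s2E /= /upd /= (negbTE kj) ag1.2.
  eapply (@runs_seq _ _ _ _ _ _ _ (fun s3 => rmem s3 2 j = abs_colsum n a j /\
      forall k, k != j -> rmem s3 2 k = rmem s 2 k)).
    apply: (@for_rule _ _ _ _ _ s2 (Y ^ 1) n (fun i s3 =>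
      rmem s3 2 j = \sum_(i' < i) `|a i' j| /\ forall k, k != j -> rmem s3 2 k = rmem s 2 k)) => //.
      by rewrite big_ord0; split; [rewrite s2E /= /upd !eqxx|exact: o2].
    move=> i s3 ni ag3 v3 [b3 o3].
    have j3 : nmem s3 10 0 = j by rewrite ag3.1.
    eapply runs_le.
      apply: (@runs_if _ _ _ _ _ _ 20); rewrite /= v3 j3 -/a => h.
        eapply runs_le; first apply: runs_rset.
          rewrite /= v3 j3 b3 big_ord_recr /= (ger0_norm h) /upd !eqxx /=; split=> // k kj.
          by rewrite (negbTE kj) o3.
        by [].
      rewrite -ltNge in h; eapply runs_le; first apply: runs_rset.
        rewrite /= v3 j3 b3 big_ord_recr /= (ltr0_norm h) /upd !eqxx /=; split=> // k kj.
        by rewrite (negbTE kj) o3.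
      by [].
    by rewrite expn1 cY.
  move=> s3 ag3 [b3 o3].
  have c3 : rmem s3 4 0 = colsum n p a j by rewrite ag3.2 // ag2.2.
  have j3 : nmem s3 10 0 = j by rewrite ag3.1.
  apply: (@for_rule _ _ _ _ _ s3 (Y ^ 5) n (fun i s4 =>
      rmem s4 2 j = halve p (colsum n p a j) (abs_colsum n a j) i /\
      forall k, k != j -> rmem s4 2 k = rmem s 2 k)) => //.
  move=> i s4 ni ag4 v4 [b4 o4].
  have j4 : nmem s4 10 0 = j by rewrite ag4.1.
  have c4 : rmem s4 4 0 = colsum n p a j by rewrite ag4.2.
  eapply runs_le.
    eapply runs_seq; first exact: rpow_runs.
    move=> s5 ag5 r5; rewrite /= j4 b4 in r5.
    have j5 : nmem s5 10 0 = j by rewrite ag5.1.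
    have b5 : rmem s5 2 j = rmem s4 2 j by rewrite ag5.2.
    have o5 k : k != j -> rmem s5 2 k = rmem s 2 k by move=> kj; rewrite ag5.2 // o4.
    apply: (@runs_if _ _ _ _ _ _ 20); rewrite /= r5 ag5.2 // c4 => h.
      eapply runs_le; first apply: runs_rset.
        rewrite /= j5 b5 b4 /upd !eqxx /= h; split=> // k kj.
        by rewrite (negbTE kj) o5.
      by [].
    eapply runs_le; first apply: runs_skip.
      by rewrite /= b5 b4 (negbTE h).
    by [].
  rewrite -[leqRHS]muln1; apply: add_pow; last exact: const_pow.
  by apply: pow_mono (tfor_leY (k := 1) (z := 1) Y2 _ _ p_le _ _) => //; rewrite /= cY.
rewrite -[leqRHS]muln1; apply: add_pow.
  apply: (@pow_mono 6) => //; rewrite muln1 (expnD Y 4 2) leq_mul2l; apply/orP; right.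
  by rewrite -mulnn; move: n_le Y2; clear; nia.
apply: add_pow; first exact: const_pow.
apply: add_pow.
  by apply: pow_mono (tfor_leY (k := 1) (z := 1) Y2 _ _ n_le _ _) => //; [rewrite muln1|rewrite cY].
by apply: pow_mono (tfor_leY (k := 5) (z := 1) Y2 _ _ n_le _ _) => //; [rewrite muln1|rewrite cY].
Qed.

Let npow_time E B' cb ce : (E <= Y)%N -> (B' <= Y)%N -> (cb + ce + 40 <= 200)%N ->
  (E * (B' * (cb + 22) + cb + ce + 40) + ce + 20 <= Y ^ 5 * 1)%N.
Proof.
move=> EY BY c200.
have h1 : (B' * (cb + 22) + cb + ce + 40 <= Y ^ 3)%N.
  rewrite !expnS expn0 muln1.
  have : (B' * (cb + 22) <= Y * Y)%N by rewrite leq_mul // cY //; lia.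
  have := cY c200; nia.
have := leq_mul EY h1; rewrite muln1 (expnS Y 4) (expnS Y 3).
have := Y_pow (isT : (0 < 3)%N); set z := (Y ^ 3)%N.
have : (ce + 20 <= Y)%N by apply: cY; lia.
nia.
Qed.

Lemma setup_runs s : runs x setup s (Y ^ 20 * m.+1) (fun s' => pars s' /\ nmem s' 5 0 = P).
Proof.
have SY : (S <= Y)%N by apply: leq_trans S_le; rewrite leq_addr.
have LY : (L <= Y)%N by apply: leq_trans L_le; rewrite /L /ntv; lia.
eapply runs_le.
  eapply runs_seq; first exact: compute_W_runs.
  move=> s1 ag1 w1.
  eapply runs_seq; first by apply: (@npow_runs _ _ 1 19 20 21 _ _ s1 W p.+1) => //=; rewrite addn1.
  move=> s2 ag2 l2; have w2 : nmem s2 0 0 = W by rewrite ag2.1.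
  eapply runs_seq.
    by apply: (@npow_runs _ _ 2 19 20 21 _ _ s2 W (3 * p).+3) => //=; rewrite -/p; lia.
  move=> s3 ag3 r3; have w3 : nmem s3 0 0 = W by rewrite ag3.1.
  have l3 : nmem s3 1 0 = L by rewrite ag3.1.
  have M3 := @mul_runs _ x 3 20 NRows (nvar 1) s3 isT isT isT.
  rewrite /= l3 in M3.
  eapply runs_seq; first exact: M3.
  move=> s4 ag4 r4.
  eapply (@runs_seq _ _ _ _ _ _ _ (fun s5 => nmem s5 4 0 = B)).
    by apply: runs_nset; rewrite /= /upd /= r4.
  move=> s5 ag5 r5.
  have S5 : nmem s5 2 0 = S by rewrite ag5.1 // ag4.1.
  eapply runs_seq.
    by apply: (@npow_runs _ _ 5 19 20 21 _ _ s5 B (S + S)) => //=; rewrite S5.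
  move=> s6 ag6 r6; eapply runs_imp.
    apply: (@for_rule _ _ _ _ _ s6 (Y ^ 12) m
      (fun i s' => forall j, (j < i)%N -> rmem s' 2 j = scale n p a j)) => //.
    move=> j s7 jm ag7 v7 I7.
    eapply runs_imp; first exact: compute_scale_runs v7.
    move=> s8 _ [e8 o8] k; rewrite ltnS => kj /=.
    have [->//|kn] := eqVneq k j.
    by rewrite o8 // I7 // ltn_neqAle kn.
  move=> s7 ag7 I7; split; last by rewrite ag7.1.
  split; last by move=> j jm; rewrite I7 // b_def.
  split; rewrite ag7.1 // ag6.1 //.
  - by rewrite ag5.1 // ag4.1.
  - by rewrite ag5.1 // ag4.1.
  - by rewrite ag5.1.
have Z k : (Y ^ k * 1 <= Y ^ k * m.+1)%N by rewrite leq_mul2l orbT.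
apply: add_pow; first by apply: (@pow_mono 6) => //; rewrite leq_pmulr.
apply: add_pow.
  by apply: (@pow_mono 5) => //; apply: leq_trans (Z _); apply: npow_time => //; lia.
apply: add_pow.
  by apply: (@pow_mono 5) => //; apply: leq_trans (Z _); apply: npow_time.
apply: add_pow.
  apply: (@pow_mono 3) => //; apply: leq_trans (Z _); rewrite !expnS expn0 !muln1 /=.
  by move: LY Y_big; clear; nia.
apply: add_pow; first exact: const_pow.
apply: add_pow.
  by apply: (@pow_mono 5) => //; apply: leq_trans (Z _); apply: npow_time.
have := tfor_le (k := 12) (z := 1) (T := Y ^ 12) m Y2 isT isT.
by rewrite muln1 mul1n => /(_ _ (leqnn _)) h; apply: pow_mono (h _ _) => //; rewrite cY.
Qed.

Lemma program_runs s : runs x rank_one_program s (Y ^ 22 * m.+1) (fun s' =>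
  let c := amin (guess_cost n m p a W b) P in
  cost n m p a (fun i => rmem s' 0 i) (fun j => rmem s' 1 j) = guess_cost n m p a W b c).
Proof.
have P_gt0 : (0 < P)%N by rewrite expn_gt0 /ubase addn1.
eapply runs_le.
  eapply runs_seq; first exact: setup_runs.
  move=> s1 ag1 [ps1 P1].
  eapply runs_seq.
    apply: (@argmin_runs _ _ _ _ _ _ _ s1 (Y ^ 15 * m.+1) P (guess_cost n m p a W b)) => //.
    move=> c s2 cP ag2 v2.
    have ps2 : pars s2 by apply: pars_agree ps1; first exact: ag2.
    by eapply runs_imp; [exact: try_guess_runs cP|move=> s3 _ []].
  move=> s2 ag2 c2.
  have ps2 : pars s2 by apply: pars_agree ps1; first exact: ag2.
  eapply (@runs_seq _ _ _ _ _ _ _ (fun s3 => nmem s3 6 0 = amin (guess_cost n m p a W b) P)).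
    by apply: runs_nset; rewrite /= /upd /= c2.
  move=> s3 ag3 c3.
  have ps3 : pars s3 by apply: pars_agree ps2; first exact: ag3.
  eapply runs_imp; first by apply: try_guess_runs c3 _ => //; exact: amin_lt.
  move=> s4 _ [_ u4 v4] /=.
  apply: eq_bigr => i _; apply: eq_bigr => j _.
  by rewrite u4 // v4.
apply: add_pow; first by apply: (@pow_mono 20).
apply: add_pow.
  by apply: pow_mono (tfor_leY (k := 15) (z := m.+1) Y2 _ _ P_le _ _) => //; rewrite cY.
apply: add_pow; first exact: const_pow.
exact: (@pow_mono 15).
Qed.

End Correctness.

(** * The running time as a power of the number of rows *)

Definition run_bound (n p W : nat) : nat :=
  (200 + (3 * p).+3 + n + (nsamp p W + nsamp p W) + ntv p W + ubase n p W
   + nguess n p W + W)%N.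

(** The number of guesses dominates: both [run_bound] and [2 * N] are at most [nguess ^ 2], which
    gives the exponent [46 = 2 + 2 * 22]. With [ubase <= N ^ (W ^ (p + 3))] and [2 * nsamp] digits
    the total exponent is at most [92 * W ^ (4 * p + 6)], and [W] absorbs 92. *)
Lemma run_bound_le n p W : (0 < n)%N -> (200 <= W)%N ->
  (2 * maxn n 2 * run_bound n p W ^ 22 <= maxn n 2 ^ (W ^ (4 * p + 7)))%N.
Proof.
move=> n0 W200; set N := maxn n 2.
have N2 : (2 <= N)%N by rewrite leq_maxr.
have W0 : (0 < W)%N by lia.
have L0 : (0 < tgrid p W)%N by rewrite expn_gt0 W0.
have S0 : (0 < nsamp p W)%N by rewrite expn_gt0 W0.
have WL : (W <= tgrid p W)%N by rewrite /tgrid expnS leq_pmulr // expn_gt0 W0.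
have LB : (2 * tgrid p W + 1 <= ubase n p W)%N by rewrite /ubase /ugrid; nia.
have nB : (2 * n + 1 <= ubase n p W)%N by rewrite /ubase /ugrid; nia.
have BP : (ubase n p W <= nguess n p W)%N.
  by rewrite /nguess -{1}(expn1 (ubase n p W)) leq_pexp2l //; lia.
have SP : (nsamp p W + nsamp p W <= nguess n p W)%N.
  by rewrite ltnW // /nguess ltn_expl //; lia.
have pS : ((3 * p).+3 <= nsamp p W)%N by rewrite ltnW // /nsamp ltn_expl //; lia.
have Pbig : (400 <= nguess n p W)%N by lia.
have YP : (run_bound n p W <= nguess n p W ^ 2)%N.
  rewrite -mulnn /run_bound /ntv; nia.
have NP : (2 * N <= nguess n p W ^ 2)%N by rewrite -mulnn /N; nia.
have step1 : (2 * N * run_bound n p W ^ 22 <= nguess n p W ^ 46)%N.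
  apply: (@leq_trans (nguess n p W ^ 2 * (nguess n p W ^ 2) ^ 22)%N).
    by apply: leq_mul => //; rewrite leq_exp2r.
  by rewrite -expnM -expnD.
(* From [W <= 2 ^ W <= N ^ W], the factor [tgrid] is also bounded by a power of [N]. *)
have BN : (ubase n p W <= N ^ (W ^ (p + 3)))%N.
  apply: (@leq_trans (N ^ (3 + W * p.+1))%N).
    rewrite expnD expnM.
    have h1 : (tgrid p W <= (N ^ W) ^ p.+1)%N.
      rewrite /tgrid leq_exp2r // (leq_trans (ltnW (ltn_expl W (isT : (1 < 2)%N)))) //.
      by rewrite leq_exp2r.
    apply: (@leq_trans (4 * n * tgrid p W)%N); first by rewrite /ubase /ugrid; nia.
    apply: leq_mul => //; rewrite !expnS expn0 muln1.
    have : (n <= N)%N by rewrite leq_maxl.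
    nia.
  rewrite leq_pexp2l //; first by lia.
  rewrite addn3 2!expnS; have := ltn_expl p.+1 (isT : (1 < 2)%N).
  have : (2 ^ p.+1 <= W ^ p.+1)%N by rewrite leq_exp2r //; lia.
  set z := (W ^ p.+1)%N; nia.
apply: (leq_trans step1); rewrite /nguess -expnM.
apply: (@leq_trans ((N ^ (W ^ (p + 3))) ^ ((nsamp p W + nsamp p W) * 46))%N).
  by rewrite leq_exp2r // muln_gt0 addn_gt0 S0.
rewrite -expnM leq_pexp2l //; first by lia.
rewrite (_ : (4 * p + 7)%N = (p + 3 + (1 + (3 * p).+3))%N); last by lia.
rewrite (expnD W (p + 3)) leq_mul2l; apply/orP; right.
rewrite (expnD W 1) expn1 -/(nsamp p W); nia.
Qed.

Lemma run_bound_ge n p W : let Y := run_bound n p W in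
  [/\ (200 <= Y)%N, ((3 * p).+3 <= Y)%N, (n <= Y)%N & (nsamp p W + nsamp p W <= Y)%N] /\
  [/\ (ntv p W <= Y)%N, (ubase n p W <= Y)%N, (nguess n p W <= Y)%N & (W <= Y)%N].
Proof.
rewrite /run_bound /=.
by move: (nsamp p W) (ntv p W) (ubase n p W) (nguess n p W) => S N B P; split; split; lia.
Qed.

(** * The constant in the exponent, and the conclusion *)

Section Final.
Variable R : realType.

Lemma program_approximates (x : input R) (W : nat) s :
  let p := in_power x in let n := in_rows x in let m := in_cols x in
  (0 < p)%N -> ~~ odd p -> (0 < n)%N -> (200 <= W)%N ->
  1024 ^+ p <= W%:R * in_eps x ->
  (forall k, (k < W)%N -> ~~ (1024 ^+ p <= k%:R * in_eps x)) ->
  runs x rank_one_program s (run_bound n p W ^ 22 * m.+1) (fun s' => forall u v,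
    cost n m p (entry x) (rmem s' 0) (rmem s' 1) <=
    cost n m p (entry x) u v + in_eps x * \sum_(j < m) colsum n p (entry x) j).
Proof.
move=> p n m p0 pev n0 W200 Wl Wm.
have [[y1 y2 y3 y4] [y5 y6 y7 y8]] := run_bound_ge n p W.
eapply runs_imp.
  exact: (@program_runs R x W (scale n p (entry x)) (run_bound n p W) y1 y2 y3 y4 y5 y6 y7 y8 erefl Wl Wm).
move=> s' _ E u v.
have scP := scaleP n (entry x) p0 pev.
have := @guess_correct R n m p (entry x) W (scale n p (entry x)) p0 pev n0.
move=> /(_ (leq_trans (isT : (4 <= 200)%N) W200)) H.
rewrite [leLHS]E; apply: H Wl _ _.
- by move=> j; case: (scP j).
- by move=> j _; case: (scP j).
- by move=> j _; case: (scP j).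
Qed.

(** The exponent [W ^ e] is at most [G ^+ e * eps ^- e]. As [N >= 2], the summand
    [G ^+ e / ln 2 ^+ 2] of [c], multiplied by [ln N ^+ 2], covers [G ^+ e]; the summand [e] ensures
    that [eps] to the power [- c] is at least [eps ^- e]. *)
Lemma time_bound_ge (p : nat) (G : R) : 0 <= G -> exists2 c : R, 0 < c &
  forall (n m W : nat) (eps : R), (0 < n)%N -> 0 < eps < 1 -> (200 <= W)%N ->
    W%:R <= G / eps ->
    (run_bound n p W ^ 22 * m.+1)%:R <= time_bound c n m eps.
Proof.
move=> G0; pose e := (4 * p + 7)%N.
have ln2 : 0 < ln 2 :> R by rewrite ln_gt0 // ltr1n.
have q0 : 0 <= G ^+ e / ln 2 ^+ 2 by rewrite divr_ge0 ?exprn_ge0 // ltW.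
exists (e%:R + G ^+ e / ln 2 ^+ 2).
  by apply: ltr_wpDr => //; rewrite ltr0n /e addnS.
set c := _ + _ => n m W eps n0 /andP[e0 e1] W200 We; rewrite /time_bound.
set N := maxn n 2; have N2 : (2 <= N)%N by rewrite leq_maxr.
have N0 : 0 < N%:R :> R by rewrite ltr0n ltnW.
have h1 : (2 * N * run_bound n p W ^ 22)%:R <= N%:R `^ (c * ln N%:R ^+ 2 * eps `^ (- c)).
  apply: (@le_trans _ _ ((N ^ (W ^ e))%N%:R)); first by rewrite ler_nat run_bound_le.
  rewrite natrX -(powR_mulrn (W ^ e) (ltW N0)); apply: ler_powR; first by rewrite ler1n ltnW.
  rewrite natrX; apply: (@le_trans _ _ (G ^+ e * eps ^- e)).
    by rewrite -exprVn -exprMn lerXn2r ?nnegrE // mulr_ge0 // invr_ge0 ltW.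
  apply: ler_pM; rewrite ?exprn_ge0 ?invr_ge0 ?exprn_ge0 ?(ltW e0) //.
    have lnN : ln 2 <= ln N%:R :> R by rewrite ler_ln ?posrE // ler_nat.
    apply: (@le_trans _ _ (c * ln 2 ^+ 2)).
      have ln2n : ln 2 ^+ 2 != 0 :> R by rewrite gt_eqF // exprn_gt0.
      by rewrite /c mulrDl divfK // lerDr mulr_ge0 // sqr_ge0.
    rewrite ler_wpM2l ?addr_ge0 //.
    by rewrite lerXn2r ?nnegrE ?(ltW ln2) // (le_trans (ltW ln2)).
  have ec : e%:R <= c by rewrite lerDl.
  have e01 : 0 < eps <= 1 by rewrite e0 ltW.
  rewrite powRN lef_pV2 ?posrE ?exprn_gt0 ?powR_gt0 //.
  by rewrite -powR_mulrn ?(ltW e0) // ger_powR.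
have mN0 : 0 <= (maxn N m)%:R / N%:R :> R by rewrite divr_ge0.
(* The factor [2 * N] turns the quotient [maxn N m / N] into [2 * maxn N m], which is at least
   [m.+1]. *)
apply: (le_trans _ (ler_wpM2l mN0 h1)).
rewrite natrM (natrM _ (2 * N)) natrM.
rewrite [leRHS](_ : _ = (run_bound n p W ^ 22)%:R * (2 * (maxn N m)%:R)); last first.
  by field; rewrite gt_eqF.
apply: ler_wpM2l; first exact: ler0n.
by rewrite -natrM ler_nat; move: (leq_maxr N m) (leq_maxl N m) N2; clear; lia.
Qed.

End Final.

Theorem theorem6p1 (R : realType) :
  exists prog : cmd,
  forall p : nat, (0 < p)%N -> ~~ odd p ->
  exists2 c : R, 0 < c &
  forall (n m k : nat) (A : 'M[R]_(n, m)) (eps : R),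
    (0 < n)%N -> (0 < m)%N -> 0 < eps < 1 ->
    let x := Input A k p eps in
    exists T : nat,
      [/\ T%:R <= time_bound c n m eps,
          runs_in prog x T &
          99%:R / 100%:R <=
            prob_output prog x T (fun s =>
              lpnorm p (A - outu n s *m (outv m s)^T) ^+ p
                <= opt_lra p A + eps * lpnorm p A ^+ p)].
Proof.
exists rank_one_program => p p0 pev.
pose K : R := 1024 ^+ p.
have K200 : 200%:R <= K.
  have h : 1 <= 1024%:R :> R by rewrite ler1n.
  apply: (@le_trans _ _ (1024%:R ^+ 1)); first by rewrite expr1 ler_nat.
  exact: ler_weXn2l.
have K0 : 0 <= K by apply: le_trans K200; rewrite ler0n.
have K20 : 0 <= 2 * K by rewrite mulr_ge0.
have [c c0 cT] := time_bound_ge p K20.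
exists c => // n m k A eps n0 m0 e01 x; have /andP[e0 e1] := e01.
have exW : exists W : nat, K <= W%:R * eps.
  exists (Num.truncn (K / eps)).+1.
  by rewrite -ler_pdivrMr // ltW // truncnS_gt.
case: (ex_minnP exW) => W Wl Wm.
have W200 : (200 <= W)%N.
  by rewrite -(ler_nat R); apply: (le_trans K200); apply: (le_trans Wl); rewrite ler_piMr // ltW.
(* Minimality gives [(W - 1) * eps < K], and [eps <= K]; hence the constant [2 * K]. *)
have Wup : W%:R <= 2 * K / eps.
  have : ~~ (K <= W.-1%:R * eps).
    by apply/negP => /Wm; rewrite leqNgt prednK ?leqnn //; exact: leq_trans W200.
  rewrite -ltNge ler_pdivlMr // => h.
  have : (1 + W.-1%:R) * eps = W%:R * eps by rewrite nat1r prednK //; exact: leq_trans W200.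
  have : eps <= K by apply: (le_trans (ltW e1)); apply: le_trans K200; rewrite ler1n.
  by move: h; clear; lra.
exists (run_bound n p W ^ 22 * m.+1)%N.
pose a := entry x.
have aE (i : 'I_n) (j : 'I_m) : a i j = A i j by rewrite /a /entry !valK.
have lpE (M : 'M[R]_(n, m)) : lpnorm p M ^+ p = \sum_(i < n) \sum_(j < m) M i j ^+ p.
  rewrite /lpnorm -powR_mulrn ?powR_ge0 // -powRrM mulVf ?pnatr_eq0 -?lt0n // powRr1; last first.
    by apply: sumr_ge0 => i _; apply: sumr_ge0 => j _; exact: powR_ge0.
  by apply: eq_bigr => i _; apply: eq_bigr => j _; rewrite powR_mulrn // even_expr_norm.
have lpcost (u v : nat -> R) :
    lpnorm p (A - (\col_(i < n) u i) *m (\col_(j < m) v j)^T) ^+ p = cost n m p a u v.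
  rewrite lpE; apply: eq_bigr => i _; apply: eq_bigr => j _; congr (_ ^+ _).
  by rewrite !mxE big_ord1 !mxE aE.
have normE : lpnorm p A ^+ p = \sum_(j < m) colsum n p a j.
  by rewrite lpE exchange_big; apply: eq_bigr => j _; apply: eq_bigr => i _; rewrite aE.
have run w : runs x rank_one_program (init R w) (run_bound n p W ^ 22 * m.+1) (fun s =>
    lpnorm p (A - outu n s *m (outv m s)^T) ^+ p <= opt_lra p A + eps * lpnorm p A ^+ p).
  eapply runs_imp.
    apply: (@program_approximates R x W (init R w) p0 pev n0 W200 Wl).
    by move=> q qW; apply/negP => /Wm; rewrite leqNgt qW.
  move=> s _ H; rewrite normE [leLHS](lpcost (rmem s 0) (rmem s 1)) -lerBlDr.
  (* The optimum is an infimum over a nonempty set, so it is enough to compare with each pair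
     [(u, v)]. *)
  apply: lb_le_inf.
    by exists (lpnorm p (A - 0 *m (0 : 'cV[R]_m)^T) ^+ p), (0, 0).
  move=> _ [[u v] _ <-]; rewrite lerBlDr.
  pose u' (i : nat) := if insub i is Some i' then u (i' : 'I_n) 0 else 0.
  pose v' (j : nat) := if insub j is Some j' then v (j' : 'I_m) 0 else 0.
  have uE : \col_(i < n) u' i = u by apply/matrixP => i j; rewrite !mxE /u' valK ord1.
  have vE : \col_(j < m) v' j = v by apply/matrixP => i j; rewrite !mxE /v' valK ord1.
  by have := H u' v'; rewrite -[cost _ _ _ _ u' v']lpcost uE vE.
split.
- exact: cT.
- by move=> w; have [t [s [h1 h2 _]]] := run w; exists t, s.
(* Every coin sequence leads to success, so the probability is one. *)
have card_full (N : nat) (E : {set N.-tuple bool}) : (forall w, w \in E) -> #|E| = (2 ^ N)%N.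
  by move=> h; rewrite -card_bool -card_tuple; apply: eq_card => w; rewrite h inE.
rewrite /prob_output card_full.
  by rewrite natrX divff ?expf_neq0 ?pnatr_eq0 // ler_pdivrMr ?ltr0n // mul1r ler_nat.
by move=> w; rewrite inE; apply/asboolP; have [t [s [_ h2 h3]]] := run w; exists t, s.
Qed.
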